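(* Let $T_0=0$ a.s. and, for $n\ge 0$, $$T_{n+1}=T_n-\sum_{k=1}^M \Phi^{(k)}\frac{\log W_n}{q^{(k)}_{Z_n}},$$ and define the continuous-time stochastic process $X=\{X(t):t\ge 0\}$ by $$X(t)=\sum_{n=0}^{\infty} Z_n\,\mathbb{1}_{[T_n,T_{n+1})}(t),\qquad X(0)=X_0 .$$ Then the stochastic process $X$ has the following properties: (i) it has the representation of the mixture process, $X(t)=\sum_{m=1}^M \Phi^{(m)}X^{(m)}(t)$ for $t\ge 0$, with $$X^{(m)}(t):=\sum_{n=0}^\infty Z^{(m)}_n\,\mathbb{1}_{[T_n,T_{n+1})}(t);$$ (ii) it has the same distribution as the mixture of Markov jump processes with intensity matrices $\mathbf{Q}^{(1)},\dots,\mathbf{Q}^{(M)}$ and switching probability matrices $\mathbf{S}^{(1)},\dots,\mathbf{S}^{(M)}$, namely the one given by the transition probability matrix $$\mathbf{P}(t)=\sum_{m=1}^M \mathbf{S}^{(m)}e^{\mathbf{Q}^{(m)}t},\qquad \text{i.e.}\qquad \mathbb{P}\{X(t)=j\mid X(0)=i\}=\Big[\sum_{m=1}^M \mathbf{S}^{(m)}e^{\mathbf{Q}^{(m)}t}\Big]_{i,j},$$ for all $t\ge 0$ and $i,j\in\mathbb{S}$.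
   Context: State space $\mathbb{S}=\{1,\dots,p\}$, number of regimes $M$. For $m=1,\dots,M$, $\mathbf{Q}^{(m)}$ is a $p\times p$ intensity matrix with entries satisfying $q_{ii}^{(m)}\le 0$, $q_{ij}^{(m)}\ge 0$ for $j\neq i$, and $\sum_{j\ne i}q_{ij}^{(m)}=-q_{ii}^{(m)}=q_i^{(m)}$. The matrix $\boldsymbol{\Pi}^{(m)}$ has entries $\pi_{ij}^{(m)}=q_{ij}^{(m)}/q_i^{(m)}$ for $j\neq i$ and $\pi_{ii}^{(m)}=0$. $\boldsymbol{\pi}=(\pi_1,\dots,\pi_p)$ is a probability distribution on $\mathbb{S}$. For every $i\in\mathbb{S}$, $0\le s_i^{(m)}\le 1$ and $\sum_{m=1}^M s_i^{(m)}=1$, and $\mathbf{S}^{(m)}=\mathrm{diag}(s_1^{(m)},\dots,s_p^{(m)})$. The mixture of Markov jump processes is the process equal to $\sum_{m=1}^M\Phi^{(m)}X^{(m)}(t)$, where the $X^{(m)}$ are independent right-continuous Markov jump processes on $\mathbb{S}$ with intensity matrices $\mathbf{Q}^{(m)}$, $\Phi^{(m)}=\mathbb{1}_{\{\phi=m\}}$, and the (unobservable) speed regime $\phi$ satisfies $\mathbb{P}\{\phi=m\mid X_0=i\}=s_i^{(m)}$; its transition probability matrix is $\sum_{m=1}^M \mathbf{S}^{(m)}e^{\mathbf{Q}^{(m)}t}$. For the construction, let $U_0,U,(V_n)_{n\ge1},(W_n)_{n\ge0}$ be independent uniform $[0,1]$ random variables. The initial state is $X_0=\sum_{k=1}^p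 k\,\mathbb{1}_{[\sum_{i=1}^{k-1}\pi_i,\ \sum_{i=1}^{k}\pi_i)}(U_0)$. Given $X_0=i_0$, the regime is $\phi=\sum_{m=1}^M m\,\mathbb{1}_{[\sum_{k=1}^{m-1}s_{i_0}^{(k)},\ \sum_{k=1}^m s_{i_0}^{(k)})}(U)$. Put $\Phi^{(m)}=\mathbb{1}_{\{\phi=m\}}$. Empty sums are zero. For each $m$, the Markov chain $Z^{(m)}$ with transition matrix $\boldsymbol{\Pi}^{(m)}$ is defined by $Z_0^{(m)}=X_0$ and $$Z_{n+1}^{(m)}=\sum_{k=1}^p k\,\mathbb{1}_{[\sum_{j=1}^{k-1}[\boldsymbol{\Pi}^{(m)}]_{Z^{(m)}_n,j},\ \sum_{j=1}^{k}[\boldsymbol{\Pi}^{(m)}]_{Z^{(m)}_n,j})}(V_{n+1}).$$ The mixture of Markov chains $(Z_n)$ is defined by $Z_0=X_0$ a.s. and $$Z_{n+1}=\sum_{k=1}^p\sum_{m=1}^M k\,\Phi^{(m)}\,\mathbb{1}_{[\sum_{j=1}^{k-1}[\boldsymbol{\Pi}^{(m)}]_{Z_n,j},\ \sum_{j=1}^{k}[\boldsymbol{\Pi}^{(m)}]_{Z_n,j})}(V_{n+1}).$$ *)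

(* Defs.v *)
From HB Require Import structures.
From mathcomp Require Import all_boot all_order all_algebra.
From mathcomp Require Import all_classical all_reals all_analysis.

Set Implicit Arguments.
Unset Strict Implicit.
Unset Printing Implicit Defensive.

Import Order.TTheory GRing.Theory Num.Theory.
Import numFieldNormedType.Exports.
Local Open Scope classical_set_scope.
Local Open Scope ring_scope.

(* States are labelled 1, ..., p and regimes 1, ..., M: the index i of type
   'I_p stands for the state i.+1, and m of type 'I_M for the regime m.+1.
   Labels are natural numbers because the inverse-transform sums below take the
   value 0 on null events (e.g. U0 = 1), which is not a state. *)

Definition label (R : realType) (p : nat) (i : 'I_p) : R := i.+1%:R.

(* f at the state labelled z; 0 if z is not a label *)
Definition at_label (R : realType) (p : nat) (f : 'I_p -> R) (z : nat) : R :=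
  \sum_(i < p | i.+1 == z) f i.

(* u \in [w_1 + ... + w_(k-1), w_1 + ... + w_k[ *)
Definition in_slot (R : realType) (n : nat) (w : 'I_n -> R) (k : 'I_n) (u : R)
  : bool := \sum_(j < n | (j < k)%N) w j <= u < \sum_(j < n | (j <= k)%N) w j.

Definition select (R : realType) (n : nat) (w : 'I_n -> R) (u : R) : nat :=
  (\sum_(k < n) k.+1 * in_slot w k u)%N.

Record is_intensity (R : realType) (p : nat) (Q : 'M[R]_p) : Prop := {
  intensity_diag : forall i, Q i i <= 0;
  intensity_offdiag : forall i j, j != i -> 0 <= Q i j;
  intensity_row : forall i, \sum_(j < p | j != i) Q i j = - Q i i }.

Definition is_distribution (R : realType) (p : nat) (w : 'rV[R]_p) : Prop :=
  (forall i, 0 <= w ord0 i) /\ \sum_(i < p) w ord0 i = 1.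

Definition is_switching (R : realType) (p M : nat) (s : 'I_M -> 'rV[R]_p)
  : Prop :=
  (forall m i, 0 <= s m ord0 i <= 1) /\
  (forall i, \sum_(m < M) s m ord0 i = 1).

(* For an absorbing state (Q i i = 0) the i-th row is 0, as x / 0 = 0 in R;
   it is never used before time +oo, see [jump_time]. *)
Definition jump_matrix (R : realType) (p : nat) (Q : 'M[R]_p) : 'M[R]_p :=
  \matrix_(i < p, j < p) (if j == i then 0 else Q i j / (- Q i i)).

Definition expm (R : realType) (p : nat) (A : 'M[R]_p) : 'M[R]_p :=
  \matrix_(i < p, j < p) limn (series (fun k => (A ^+ k) i j / k`!%:R)).

(* The transformations below act on one realisation of the random inputs:
   z0 is the initial label, phi the regime, v and w the uniform sequences. *)

Fixpoint regime_chain (R : realType) (p : nat) (Pi : 'M[R]_p) (z0 : nat)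
    (v : nat -> R) (n : nat) : nat :=
  if n is n'.+1 then
    select (fun j => at_label (fun i => Pi i j) (regime_chain Pi z0 v n')) (v n)
  else z0.

Fixpoint mixture_chain (R : realType) (p M : nat) (Pi : 'I_M -> 'M[R]_p)
    (phi : nat) (z0 : nat) (v : nat -> R) (n : nat) : nat :=
  if n is n'.+1 then
    (\sum_(k < p) \sum_(m < M) k.+1 * (phi == m.+1) *
       in_slot (fun j => at_label (fun i => Pi m i j)
                           (mixture_chain Pi phi z0 v n')) k (v n))%N
  else z0.

(* Extended-real valued: as x^-1 = +oo for x = 0 in \bar R, the time of the jump
   out of an absorbing state is +oo. *)
Fixpoint jump_time (R : realType) (p M : nat) (Q : 'I_M -> 'M[R]_p)
    (phi : nat) (z : nat -> nat) (w : nat -> R) (n : nat) : \bar R :=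
  if n is n'.+1 then
    (jump_time Q phi z w n' -
     \sum_(k < M) (phi == k.+1)%:R%:E *
       (lne (w n')%:E / (at_label (fun i => - Q k i i)%R (z n'))%:E))%E
  else 0%E.

Definition jump_path (R : realType) (z : nat -> nat) (tau : nat -> \bar R)
    (t : R) : R :=
  limn (series (fun n =>
    (z n)%:R * (tau n <= t%:E < tau n.+1)%E%:R : R)).

Definition mutually_independent (d : measure_display) (T : measurableType d)
    (R : realType) (P : probability T R) (I : eqType) (X : I -> {RV P >-> R})
  : Prop :=
  forall (r : seq I) (B : I -> set R), uniq r ->
    (forall i, measurable (B i)) ->
    P [set w | forall i, i \in r -> B i (X i w)] =
    (\prod_(i <- r) P (X i @^-1` B i))%E.

Definition is_uniform01 (d : measure_display) (T : measurableType d)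
    (R : realType) (P : probability T R) (X : {RV P >-> R}) : Prop :=
  forall B : set R, measurable B ->
    distribution P X B = uniform_prob (@ltr01 R) B.

(* the family U0, U, (V_n)_(n >= 1), (W_n)_(n >= 0); V 0 is not used *)
Definition inputs (d : measure_display) (T : measurableType d) (R : realType)
    (P : probability T R) (U0 U : {RV P >-> R}) (V W : nat -> {RV P >-> R})
    (k : bool + (nat + nat)) : {RV P >-> R} :=
  match k with
  | inl false => U0
  | inl true => U
  | inr (inl n) => V n.+1
  | inr (inr n) => W n
  end.

(* only meaningful when P B != 0 *)
Definition cond_prob (d : measure_display) (T : measurableType d)
    (R : realType) (P : probability T R) (A B : set T) : \bar R :=
  (P (A `&` B) / P B)%E.

Definition visits (R : realType) (p : nat) (T : Type) (X : R -> T -> R)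
    (t : nat -> R) (x : nat -> 'I_p) (n : nat) : set T :=
  [set w | forall k, (k < n)%N -> X (t k) w = label R (x k)].

Record is_markov_jump_process (R : realType) (p : nat) (d : measure_display)
    (T : measurableType d) (P : probability T R) (Q : 'M[R]_p)
    (X : R -> T -> R) : Prop := {
  mjp_measurable : forall t, 0 <= t -> measurable_fun [set: T] (X t);
  mjp_state : forall t w, 0 <= t -> exists i : 'I_p, X t w = label R i;
  mjp_right_continuous : forall t w, 0 <= t ->
    X u w @[u --> t^'+] --> X t w;
  mjp_markov : forall (t : nat -> R) (x : nat -> 'I_p) (n : nat),
    0 <= t 0%N -> nondecreasing_seq t -> P (visits X t x n.+1) != 0%E ->
    cond_prob P [set w | X (t n.+1) w = label R (x n.+1)] (visits X t x n.+1) =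
    (expm ((t n.+1 - t n) *: Q) (x n) (x n.+1))%:E }.

(* The X^(m) share the initial state X0, on which the law of phi depends, so
   independence of phi, X^(1), ..., X^(M) is understood given X0. *)
Record is_mixture_of_mjp (R : realType) (p M : nat) (d : measure_display)
    (T : measurableType d) (P : probability T R) (Q : 'I_M -> 'M[R]_p)
    (ini : 'rV[R]_p) (s : 'I_M -> 'rV[R]_p) (phi : T -> nat)
    (Xm : 'I_M -> R -> T -> R) (X0 : T -> R) (Y : R -> T -> R) : Prop := {
  mix_mjp : forall m, is_markov_jump_process P (Q m) (Xm m);
  mix_start : forall m w, Xm m 0 w = X0 w;
  mix_initial : forall i : 'I_p,
    P [set w | X0 w = label R i] = (ini ord0 i)%:E;
  mix_regime_measurable : measurable_fun [set: T] phi;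
  mix_regime : forall (m : 'I_M) (i : 'I_p),
    P [set w | X0 w = label R i] != 0%E ->
    cond_prob P [set w | phi w = m.+1] [set w | X0 w = label R i] =
    (s m ord0 i)%:E;
  mix_independent : forall (m : 'I_M) (i : 'I_p) (n : nat) (t : nat -> R)
      (x : 'I_M -> nat -> 'I_p),
    P [set w | X0 w = label R i] != 0%E ->
    0 <= t 0%N -> nondecreasing_seq t ->
    cond_prob P
      ([set w | phi w = m.+1] `&`
       [set w | forall k, visits (Xm k) t (x k) n w])
      [set w | X0 w = label R i] =
    (cond_prob P [set w | phi w = m.+1] [set w | X0 w = label R i] *
     \prod_(k < M) cond_prob P (visits (Xm k) t (x k) n)
                     [set w | X0 w = label R i])%E;
  mix_repr : forall t w, 0 <= t ->
    Y t w = \sum_(m < M) (phi w == m.+1)%:R * Xm m t w }.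

(* equality of the finite-dimensional distributions on [0, +oo[ *)
Definition same_distribution (R : realType)
    (d : measure_display) (T : measurableType d) (P : probability T R)
    (X : R -> T -> R)
    (d' : measure_display) (T' : measurableType d') (P' : probability T' R)
    (Y : R -> T' -> R) : Prop :=
  forall (n : nat) (t : nat -> R) (B : nat -> set R),
    0 <= t 0%N -> nondecreasing_seq t -> (forall k, measurable (B k)) ->
    P [set w | forall k, (k < n)%N -> B k (X (t k) w)] =
    P' [set w | forall k, (k < n)%N -> B k (Y (t k) w)].

(* Main.v *)
Require Import Defs.
From HB Require Import structures.
From mathcomp Require Import all_boot all_order all_algebra.
From mathcomp Require Import all_classical all_reals all_analysis.
From mathcomp Require Import lra ring.
From mathcomp Require Import measurable_realfun.

Set Implicit Arguments.
Unset Strict Implicit.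
Unset Printing Implicit Defensive.

Import Order.TTheory GRing.Theory Num.Theory.
Import numFieldNormedType.Exports.
Local Open Scope classical_set_scope.
Local Open Scope ring_scope.

(** The path is driven by one regime, chosen at time 0. Within regime m it is the
    jump chain and holding time construction for Q^(m), started at the initial
    state and independent of the choice of this state and of the regime. So the
    theorem reduces to the classical fact that this construction has the
    finite-dimensional distributions of a Markov jump process: for an event D on
    (U0, U), the probability of D and of visiting x_1, ..., x_n at the times
    t_1 <= ... <= t_n is P(D) times the product of the entries of
    expm ((t_k - t_(k-1)) Q) ([regime_fdd]).

    This is proved by the forward equation, in an elementary form. Let A be an
    event of the past up to time u and h_j(v) the probability of A and of being in
    state j at time u + v. Split A according to the number n of jumps so far. On
    the uniform scale the current sojourn goes on as long as W_n < Y, where Y is a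
    function of the inputs read before W_n, and the lack of memory of the
    exponential law becomes P(W_n < c Y) = c P(W_n < Y) ([uniform_memoryless]).
    Hence during a short time e there is no jump with probability exp (- q e); a
    jump goes where V_(n+1) sends it; two jumps have probability O(e^2). This gives
    h(v + e) = h(v) (1 + e Q) + O(e^2), uniformly in v ([step_estimate],
    [forward_step]). The rows of the exponential obey the same relation
    ([expm_step]), and two solutions with the same start agree because 1 + e Q is
    stochastic ([discrete_gronwall]). No mass can escape to infinitely many jumps,
    as the rows of the exponential sum to 1: explosion need not be excluded
    beforehand.

    The law of any mixture of Markov jump processes is computed from its defining
    properties; summing over the paths of the regimes that were not chosen gives
    the same weights ([mixture_path_weight]). Both processes live on finitely many
    states, so that equal weights mean equal finite-dimensional distributions
    ([prob_samples]). The transition matrix is the case of one time, and the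
    representation by the processes of the regimes is an identity for every
    outcome. *)

(** * The exponential of a matrix with zero row sums *)

Section MatrixExponential.
Variables (R : realType) (p : nat) (Q : 'M[R]_p).

Let coef i j k : R := (Q ^+ k) i j / k`!%:R.

(** The entries are power series in t, so that they can be differentiated term
    by term. *)
Lemma expm_pseries (t : R) i j :
  expm (t *: Q) i j = limn (pseries (coef i j) t).
Proof.
rewrite mxE; congr (limn (series _)); apply/funext => k /=.
have -> : (t *: Q) ^+ k = t ^+ k *: Q ^+ k.
  elim: k => [|k IH]; first by rewrite !expr0 scale1r.
  by rewrite !exprS IH -!mulmxE -scalemxAl -scalemxAr scalerA.
by rewrite mxE /coef -mulrA mulrC.
Qed.

Lemma mx_pow_bound : exists2 a : R, 0 <= a &
  forall k i j, `|(Q ^+ k) i j| <= a ^+ k.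
Proof.
pose a := \sum_i \sum_j `|Q i j|; exists a.
  by rewrite sumr_ge0// => i _; rewrite sumr_ge0.
have a0 : 0 <= a by rewrite sumr_ge0// => i _; rewrite sumr_ge0.
elim => [|k IH] i j.
  by rewrite !expr0 mxE; case: eqP; rewrite ?normr1 ?normr0.
rewrite exprSr -mulmxE mxE (le_trans (ler_norm_sum _ _ _))//.
rewrite exprSr {2}/a mulr_sumr ler_sum// => l _.
rewrite normrM ler_pM//.
by rewrite (bigD1 j)//= lerDl sumr_ge0.
Qed.

Lemma expm_series_bound : exists2 a : R, 0 <= a &
  forall i j (t : R), cvgn (pseries (coef i j) t) /\
    `|expm (t *: Q) i j| <= expR (a * `|t|).
Proof.
have [a a0 ha] := mx_pow_bound; exists a => // i j t.
have le_exp n : `|coef i j n * t ^+ n| <= exp_coeff (a * `|t|) n.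
  rewrite /exp_coeff/= /coef !normrM normrX exprMn mulrAC.
  by rewrite normfV [`|n`!%:R|]ger0_norm// ler_pM2r ?invr_gt0 ?ltr0n ?fact_gt0//
    ler_wpM2r ?exprn_ge0.
have cv : cvgn (series (fun n => `|coef i j n * t ^+ n|)).
  apply: (@series_le_cvg R _ (exp_coeff (a * `|t|))) => //= [n|].
    by rewrite exp_coeff_ge0// mulr_ge0.
  exact: is_cvg_series_exp_coeff.
split; first exact: normed_cvg.
rewrite expm_pseries (le_trans (lim_series_norm _))//.
by rewrite lim_series_le//; exact: is_cvg_series_exp_coeff.
Qed.

Lemma cvg_expm_series i j (t : R) :
  pseries (coef i j) t @ \oo --> expm (t *: Q) i j.
Proof. by have [a _ /(_ i j t)[]] := expm_series_bound; rewrite expm_pseries. Qed.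

Let diffs_coef i j : pseries_diffs (coef i j) =
  fun k => \sum_l coef i l k * Q l j.
Proof.
apply/funext => k; rewrite /pseries_diffs /coef exprSr -mulmxE mxE factS natrM.
rewrite invfM mulrCA mulVKf ?pnatr_eq0//.
by rewrite mulr_suml; apply: eq_bigr => l _; rewrite mulrAC.
Qed.

Let cvg_lincomb (c : 'I_p -> nat -> R) (q : 'I_p -> R) (L : 'I_p -> R) (t : R) :
  (forall l, pseries (c l) t @ \oo --> L l) ->
  pseries (fun k => \sum_l c l k * q l) t @ \oo --> \sum_l L l * q l.
Proof.
move=> cL; rewrite (_ : pseries _ t = fun n => \sum_l pseries (c l) t n * q l).
  elim: (index_enum _) => [|l s IH].
    by rewrite big_nil; under eq_fun do rewrite big_nil; exact: cvg_cst.
  rewrite big_cons; under eq_fun do rewrite big_cons.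
  by apply: cvgD => //; apply: cvgMl; exact: cL.
apply/funext => n; rewrite /pseries /series/=.
under eq_bigr do rewrite mulr_suml.
rewrite exchange_big/=; apply: eq_bigr => l _; rewrite mulr_suml.
by apply: eq_bigr => k _; rewrite mulrAC.
Qed.

Lemma is_derive_expm i j (t : R) :
  is_derive t 1 (fun u => expm (u *: Q) i j)
    (\sum_l expm (t *: Q) i l * Q l j).
Proof.
have cv1 i' j' u : pseries (pseries_diffs (coef i' j')) u @ \oo -->
    \sum_l expm (u *: Q) i' l * Q l j'.
  by rewrite diffs_coef; apply: cvg_lincomb => l; exact: cvg_expm_series.
have cv2 u : cvgn (pseries (pseries_diffs (pseries_diffs (coef i j))) u).
  rewrite (_ : pseries_diffs (pseries_diffs _) =
     fun k => \sum_l pseries_diffs (coef i l) k * Q l j); last first.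
    rewrite diffs_coef; apply/funext => k.
    rewrite {1}/pseries_diffs mulr_sumr.
    by apply: eq_bigr => l _; rewrite /pseries_diffs mulrA.
  apply/cvg_ex; eexists; apply: cvg_lincomb => l; exact: cv1.
have -> : (fun u => expm (u *: Q) i j) = fun u => limn (pseries (coef i j) u).
  by apply/funext => u; rewrite expm_pseries.
rewrite -(cvg_lim _ (cv1 i j t))//.
apply: (@pseries_snd_diffs _ _ (`|t| + 1)).
- by apply/cvg_ex; eexists; exact: cvg_expm_series.
- by apply/cvg_ex; eexists; exact: cv1.
- exact: cv2.
- by rewrite [ltRHS]ger0_norm ?addr_ge0// ltrDl.
Qed.

Lemma expm0 i j : expm (0 *: Q) i j = (i == j)%:R.
Proof.
rewrite -(cvg_lim _ (@cvg_expm_series i j 0))//.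
apply: lim_near_cst => //; near=> n.
have n0 : (0 < n)%N by near: n; exact: nbhs_infty_gt.
rewrite /pseries /series/= big_ltn// big_nat big1 ?addr0.
  by rewrite /coef expr0 mulr1 divr1 mxE.
by move=> k /andP[k0 _]; rewrite expr0n gtn_eqF// mulr0.
Unshelve. all: by end_near. Qed.

(** Taylor's formula, the second derivatives of the entries being bounded on
    bounded intervals. *)
Lemma expm_step (t : R) : exists2 C : R, 0 <= C &
  forall i j (u e : R), 0 <= u -> 0 <= e -> u + e <= t ->
  `|expm ((u + e) *: Q) i j -
    \sum_l expm (u *: Q) i l * ((l == j)%:R + e * Q l j)| <= C * e ^+ 2.
Proof.
have [a a0 ha] := expm_series_bound.
have [b b0 hb] := mx_pow_bound.
pose C := \sum_(l < p) \sum_(k < p) expR (a * `|t|) * b * b.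
have C0 : 0 <= C.
  by rewrite sumr_ge0// => l _; rewrite sumr_ge0// => k _; rewrite !mulr_ge0// expR_ge0.
exists C => // i j u e u0 e0 ut.
pose f (i j : 'I_p) (v : R) : R := expm (v *: Q) i j.
pose f1 (i j : 'I_p) (v : R) : R := \sum_l f i l v * Q l j.
pose f2 (v : R) : R := \sum_l f1 i l v * Q l j.
have df i' j' v : is_derive v (1 : R) (f i' j') (f1 i' j' v) by exact: is_derive_expm.
have df1 v : is_derive v (1 : R) (f1 i j) (f2 v).
  have -> : f1 i j = \sum_l (Q l j *: f i l).
    apply/funext => x; rewrite fct_sumE; apply: eq_bigr => l _.
    by rewrite mulrC.
  have -> : f2 v = \sum_l (Q l j *: f1 i l v).
    by apply: eq_bigr => l _; rewrite mulrC.
  by apply: is_derive_sum => l; exact: is_deriveZ.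
have f2_le v : 0 <= v <= t -> `|f2 v| <= C.
  move=> /andP[v0 vt]; rewrite (le_trans (ler_norm_sum _ _ _))// ler_sum// => l _.
  rewrite normrM /f1 -[leRHS]mulr_suml ler_pM//.
    rewrite (le_trans (ler_norm_sum _ _ _))// ler_sum// => k _.
    rewrite normrM ler_pM//; last by have := hb 1%N k l; rewrite !expr1.
    rewrite (le_trans (ha i k v).2)// ler_expR ler_wpM2l//.
    by rewrite !ger0_norm// (le_trans v0).
  by have := hb 1%N l j; rewrite !expr1.
have cont g dg x y : (forall v : R, is_derive v (1 : R) (g : R -> R) (dg v)) ->
    {within `[x, y], continuous g}.
  move=> dg'; apply: derivable_within_continuous => v _.
  by have [] := dg' v.
have [c] := MVT_segment (ler_wpDr e0 (lexx u)) (fun x _ => df i j x)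
  (cont _ _ _ _ (df i j)).
rewrite in_itv/= => /andP[uc cue]; rewrite addrAC subrr add0r => fE.
have [c' /[!in_itv]/= /andP[uc' cc'] f1E] := MVT_segment uc (fun x _ => df1 x)
  (cont _ _ _ _ df1).
have -> : \sum_l expm (u *: Q) i l * ((l == j)%:R + e * Q l j) =
    f i j u + f1 i j u * e.
  rewrite /f1 mulr_suml [in RHS]/f.
  rewrite -[X in X + _](_ : \sum_l expm (u *: Q) i l * (l == j)%:R = _).
    rewrite -big_split/=; apply: eq_bigr => l _.
    by rewrite mulrDr [e * _]mulrC mulrA.
  by rewrite (bigD1 j)//= eqxx mulr1 big1 ?addr0// => l /negbTE ->; rewrite mulr0.
rewrite opprD addrA [X in `|X - _|]fE -mulrBl f1E expr2 mulrA normrM [`|e|]ger0_norm//.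
rewrite ler_wpM2r// normrM ler_pM//.
  by rewrite f2_le// (le_trans u0 uc')/= (le_trans cc')// (le_trans cue).
by rewrite ger0_norm ?subr_ge0// lerBlDl.
Qed.

(** A matrix with zero row sums annihilates the constant vector, so that only the
    term of order 0 of the series contributes. *)
Lemma sum_expm_row (t : R) i : (forall k, \sum_j Q k j = 0) ->
  \sum_j expm (t *: Q) i j = 1.
Proof.
move=> Q0.
have powQ0 k : \sum_j (Q ^+ k) i j = (k == 0)%:R.
  case: k => [|k]; last first.
    rewrite exprSr -mulmxE; under eq_bigr do rewrite mxE.
    rewrite exchange_big/= big1// => l _.
    by rewrite -mulr_sumr Q0 mulr0.
  rewrite expr0 (bigD1 i)//= mxE eqxx big1 ?addr0// => j /negbTE ji.
  by rewrite mxE eq_sym ji.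
have := cvg_lincomb (c := coef i) (q := fun=> 1) (t := t)
  (fun l => @cvg_expm_series i l t).
under [X in _ --> X -> _]eq_bigr do rewrite mulr1.
move=> /cvg_lim <-//; apply: lim_near_cst => //; near=> n.
have n0 : (0 < n)%N by near: n; exact: nbhs_infty_gt.
have cE k : \sum_l coef i l k * 1 = (k == 0)%:R.
  under eq_bigr do rewrite mulr1 /coef.
  by rewrite -mulr_suml powQ0; case: k => [|k]; rewrite ?mul0r// fact0 divr1.
rewrite /pseries /series/= big_ltn// big_nat [X in _ + X]big1 ?addr0.
  by rewrite cE expr0 mulr1.
by move=> k /andP[k0 _]; rewrite cE gtn_eqF// mul0r.
Unshelve. all: by end_near. Qed.

End MatrixExponential.

Lemma intensity_sum0 (R : realType) (p : nat) (Q : 'M[R]_p) :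
  is_intensity Q -> forall i, \sum_j Q i j = 0.
Proof.
by move=> iQ i; rewrite (bigD1 i)//= (intensity_row iQ) subrr.
Qed.

(** Uniqueness for the forward equation h' = h Q, in a form that asks for no
    differentiability of h. For small e the matrix 1 + e Q is stochastic, hence
    an Euler step does not increase the l1 norm; N steps of length t / N thus
    add up to an error of order N (t / N)^2. *)
Lemma discrete_gronwall (R : realType) (p : nat) (Q : 'M[R]_p)
    (h : R -> 'I_p -> R) (t C e0 : R) :
  is_intensity Q -> 0 <= t -> 0 < e0 ->
  (forall j, h 0 j = 0) ->
  (forall (u e : R) j, 0 <= u -> 0 <= e -> e <= e0 -> u + e <= t ->
    `|h (u + e) j - \sum_l h u l * ((l == j)%:R + e * Q l j)| <= C * e ^+ 2) ->
  forall j, h t j = 0.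
Proof.
move=> iQ t0 e0_gt0 h0 hstep j0.
pose D (u : R) : R := \sum_j `|h u j|.
have S0 : 0 <= \sum_l - Q l l.
  by rewrite sumr_ge0// => l _; rewrite oppr_ge0; exact: intensity_diag.
(* Steps of length at most e1 keep the diagonal of 1 + e Q nonnegative. *)
pose e1 := (1 + \sum_l - Q l l)^-1.
have e1_gt0 : 0 < e1 by rewrite invr_gt0 ltr_wpDr.
have he1 (l : 'I_p) (e : R) : 0 <= e -> e <= e1 -> 0 <= 1 + e * Q l l.
  move=> e_ge0; rewrite -[e <= _](@ler_pM2r _ (1 + \sum_l - Q l l)) ?ltr_wpDr//.
  rewrite mulVf ?lt0r_neq0 ?ltr_wpDr// => e1S.
  rewrite -lerBlDr sub0r -mulrN (le_trans _ e1S)// ler_wpM2l//.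
  rewrite (bigD1 l)//= addrCA lerDl addr_ge0// sumr_ge0// => k _.
  by rewrite oppr_ge0; exact: intensity_diag.
have Dstep (u e : R) : 0 <= u -> 0 <= e -> e <= e0 -> e <= e1 -> u + e <= t ->
    D (u + e) <= D u + p%:R * C * e ^+ 2.
  move=> u0 e_ge0 ee0 ee1 uet.
  have nonneg (l j : 'I_p) : 0 <= (l == j)%:R + e * Q l j.
    have [<-|lj] := eqVneq l j; first exact: he1.
    by rewrite add0r mulr_ge0// (intensity_offdiag iQ)// eq_sym.
  apply: (@le_trans _ _
    (\sum_j (\sum_l `|h u l| * ((l == j)%:R + e * Q l j) + C * e ^+ 2))).
    apply: ler_sum => j _; rewrite -lerBlDl.
    apply: le_trans (hstep u e j u0 e_ge0 ee0 uet).
    apply: le_trans (lerB_dist _ _); rewrite lerB//.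
    rewrite (le_trans (ler_norm_sum _ _ _))// ler_sum// => l _.
    by rewrite normrM [X in _ * X]ger0_norm.
  rewrite big_split/= exchange_big/= sumr_const card_ord.
  rewrite -[C * e ^+ 2 *+ p]mulr_natl mulrA lerD2r.
  apply: ler_sum => l _; rewrite -mulr_sumr big_split/= -mulr_sumr.
  rewrite intensity_sum0// mulr0 addr0 (bigD1 l)//= eqxx big1 ?addr0 ?mulr1//.
  by move=> j /negbTE; rewrite eq_sym => ->.
have Dn (N n : nat) : (n <= N.+1)%N -> t / N.+1%:R <= e0 -> t / N.+1%:R <= e1 ->
  D (n%:R * (t / N.+1%:R)) <= n%:R * (p%:R * C * (t / N.+1%:R) ^+ 2).
  move=> nN te0 te1; have tN0 : 0 <= t / N.+1%:R by rewrite divr_ge0.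
  elim: n nN => [|n IH] nN.
    by rewrite !mul0r /D big1// => j _; rewrite h0 normr0.
  rewrite -natr1 !mulrDl !mul1r (le_trans (Dstep _ _ _ _ _ _ _))//.
  - by rewrite mulr_ge0.
  - rewrite -[X in _ + X]mul1r -mulrDl natr1 mulrCA ler_piMr//.
    by rewrite ler_pdivrMr ?mul1r ?ler_nat.
  - by rewrite lerD2r IH// ltnW.
have D0 : D t <= 0.
  rewrite leNgt; apply/negP => Dt.
  pose K := `|p%:R * C * t ^+ 2| / D t.
  pose N := Num.truncn (t / e0 + t / e1 + K).
  have K0 : 0 <= K by rewrite divr_ge0// ltW.
  have te00 : 0 <= t / e0 by rewrite divr_ge0// ltW.
  have te10 : 0 <= t / e1 by rewrite divr_ge0// ltW.
  have NK : t / e0 + t / e1 + K < N.+1%:R by exact: truncnS_gt.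
  have := Dn N N.+1 (leqnn _).
  rewrite mulrCA divff ?pnatr_eq0// mulr1 => H.
  have {H} : D t <= N.+1%:R * (p%:R * C * (t / N.+1%:R) ^+ 2).
    apply: H; rewrite ler_pdivrMr ?ltr0Sn// mulrC -ler_pdivrMr//; lra.
  rewrite expr_div_n.
  rewrite [X in _ <= X](_ : _ = p%:R * C * t ^+ 2 / N.+1%:R); last first.
    by field.
  rewrite ler_pdivlMr ?ltr0Sn// => H.
  have : D t * N.+1%:R <= K * D t.
    by rewrite /K mulfVK ?gt_eqF// (le_trans H)// ler_norm.
  rewrite mulrC ler_pM2r// leNgt => /negP; apply; lra.
have : `|h t j0| <= 0.
  by apply: le_trans D0; rewrite /D (bigD1 j0)//= lerDl sumr_ge0.
by rewrite normr_le0 => /eqP.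
Qed.

(** * Uniform variables and independence *)

Section Uniform.
Variable R : realType.

Lemma uniform01_lebesgue (A : set R) : measurable A ->
  uniform_prob (@ltr01 R) A = lebesgue_measure (A `&` `[0, 1]).
Proof.
move=> mA; rewrite /uniform_prob integral_uniform_pdf.
rewrite (eq_integral (fun=> 1%E)); last first.
  move=> x; rewrite inE/= in_itv/= /uniform_pdf => -[_ ->].
  by rewrite subr0 invr1.
by rewrite integral_cst//= ?mul1e//; exact: measurableI.
Qed.

Lemma measurable_lt_set (a : R) : measurable [set r : R | r < a].
Proof.
rewrite (_ : [set r | r < a] = `]-oo, a[%classic); first exact: measurable_itv.
by apply/seteqP; split => x /=; rewrite in_itv.
Qed.

Lemma uniform01_lt (a : R) : 0 <= a <= 1 ->
  uniform_prob (@ltr01 R) [set r | r < a] = a%:E.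
Proof.
move=> /andP[a0 a1]; rewrite uniform01_lebesgue; last exact: measurable_lt_set.
rewrite (_ : _ `&` _ = `[0, a[%classic).
  rewrite lebesgue_measure_itv/= lte_fin; case: ltP => [_|]; first by rewrite oppr0 adde0.
  by move=> a0'; congr EFin; apply/le_anti; rewrite a0 a0'.
apply/seteqP; split => x /=; rewrite !in_itv/=.
  by move=> [-> /andP[-> _]].
by move=> /andP[-> xa]; rewrite xa (le_trans (ltW xa)).
Qed.

Lemma uniform01_ge (a : R) : 0 <= a <= 1 ->
  uniform_prob (@ltr01 R) [set r | a <= r] = (1 - a)%:E.
Proof.
move=> a01; rewrite (_ : [set r | a <= r] = ~` [set r | r < a]).
  rewrite probability_setC; last exact: measurable_lt_set.
  by rewrite [X in (1 - X)%E](uniform01_lt a01) EFinB.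
by apply/seteqP; split => x /=; rewrite leNgt => /negP.
Qed.

Lemma uniform01_itvco (a b : R) : 0 <= a -> a <= b -> b <= 1 ->
  uniform_prob (@ltr01 R) [set r | a <= r < b] = (b - a)%:E.
Proof.
move=> a0 ab b1; rewrite (_ : [set r | a <= r < b] = `[a, b[%classic); last first.
  by apply/seteqP; split => x /=; rewrite in_itv.
rewrite uniform01_lebesgue; last exact: measurable_itv.
rewrite setIidl.
  rewrite lebesgue_measure_itv/= lte_fin; case: ltP => //.
  by move=> ba; rewrite (_ : b = a) ?subrr//; apply/le_anti; rewrite ab ba.
move=> x /=; rewrite !in_itv/= => /andP[ax xb].
by rewrite (le_trans a0)// (le_trans (ltW xb)).
Qed.

End Uniform.

Section Independence.
Context d (T : measurableType d) (R : realType) (P : probability T R).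

Section Cylinders.
Variables (I : eqType) (X : I -> {RV P >-> R}).

(** A pi-system that generates the sigma-algebra of the inputs in S. *)
Definition cylinder (S : pred I) : set (set T) :=
  [set A | exists r B, [/\ uniq r, all S r, forall i, measurable (B i) &
     A = [set w | forall i, i \in r -> B i (X i w)]]].

Lemma cylinder_setI S : setI_closed (cylinder S).
Proof.
move=> _ _ [r1 [B1 [u1 S1 m1 ->]]] [r2 [B2 [u2 S2 m2 ->]]].
exists (undup (r1 ++ r2)).
exists (fun i => (if i \in r1 then B1 i else setT) `&`
                 (if i \in r2 then B2 i else setT)); split.
- exact: undup_uniq.
- by rewrite (eq_all_r (mem_undup _)) all_cat S1.
- by move=> i; apply: measurableI; case: ifP.
- apply/seteqP; split => w /=.
    move=> [h1 h2] i; rewrite mem_undup mem_cat => _.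
    by split; case: ifPn => // ?; [exact: h1|exact: h2].
  move=> h; split => i ir; have := h i; rewrite mem_undup mem_cat ir ?orbT => /(_ isT)[] //.
Qed.

Lemma cylinder_measurable S A : cylinder S A -> measurable A.
Proof.
move=> [r [B [_ _ mB ->]]].
rewrite (_ : [set w | _] = \big[setI/setT]_(i <- r) (X i @^-1` B i)).
  apply: bigsetI_measurable => i _.
  by rewrite -[X in measurable X]setTI; exact: measurable_funP.
elim: r => [|i r IH]; first by rewrite big_nil; apply/seteqP; split.
rewrite big_cons -IH; apply/seteqP; split => w /=.
  by move=> h; split => [|j jr]; apply: h; rewrite inE ?eqxx// jr orbT.
by move=> [h1 h2] j; rewrite inE => /predU1P[->//|]; exact: h2.
Qed.

Lemma sigma_cylinder_measurable S A : <<s cylinder S>> A -> measurable A.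
Proof.
move=> sA; apply: (smallest_sub _ _ sA); last exact: cylinder_measurable.
exact: sigma_algebra_measurable.
Qed.

(** Dynkin's pi-lambda theorem lifts the product rule from cylinders. *)
Lemma independent_past (S : pred I) i A B : mutually_independent X -> ~~ S i ->
  <<s cylinder S>> A -> measurable B ->
  P (A `&` X i @^-1` B) = (P A * P (X i @^-1` B))%E.
Proof.
move=> indX Si sA mB.
have mE : measurable (X i @^-1` B).
  by rewrite -[X in measurable X]setTI; exact: measurable_funP.
set E := X i @^-1` B in mE *.
pose H : set (set T) := [set A | measurable A /\ P (A `&` E) = (P A * P E)%E].
suff : <<s cylinder S>> `<=` H by move=> /(_ A sA)[].
apply: lambda_system_subset => //.
- exact: cylinder_setI.
- split => //.
  + by split => //; rewrite setTI probability_setT mul1e.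
  + move=> A1 A2 A21 [mA1 E1] [mA2 E2]; split; first exact: measurableD.
    rewrite (_ : _ `&` E = (A1 `&` E) `\` (A2 `&` E)); last first.
      apply/seteqP; split => w /=; first by move=> [[? n] ?]; split=> // -[].
      by move=> [[? ?] n]; split => //; split => // ?; exact: n.
    have PD (C D : set T) : measurable C -> measurable D -> D `<=` C ->
        P (C `\` D) = (P C - P D)%E.
      move=> mC mD DC; rewrite measureD ?(setIidr DC)//.
      by rewrite ltey_eq fin_num_measure.
    rewrite !PD//; last 3 first.
    - exact: measurableI.
    - exact: measurableI.
    - exact: setSI.
    rewrite E1 E2 muleBl ?fin_num_measure//.
    by rewrite fin_num_adde_defr ?fin_num_measure.
  + move=> F ndF HF; have mF n : measurable (F n) by have [] := HF n.
    have mUF : measurable (\bigcup_n F n) by exact: bigcup_measurable.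
    split => //.
    apply: (@cvg_unique _ (@ereal_hausdorff R) ((fun n => P (F n `&` E)) @ \oo)).
      rewrite setI_bigcupl.
      apply: nondecreasing_cvg_mu.
      - by move=> n; exact: measurableI.
      - by apply: bigcup_measurable => n _; exact: measurableI.
      - by move=> n m nm; apply/subsetPset; apply: setSI; apply/subsetPset; exact: ndF.
    rewrite (_ : (fun n => P (F n `&` E)) = fun n => (P (F n) * P E)%E).
      apply: cvgeZr; first exact: fin_num_measure.
      exact: nondecreasing_cvg_mu.
    by apply/funext => n; exact: (HF n).2.
- move=> _ [r [B' [ur Sr mB' ->]]]; split.
    by apply: (@cylinder_measurable S); exists r, B'.
  have ir : i \notin r by apply/negP => /(allP Sr); exact/negP.
  have urr : uniq (i :: r) by rewrite /= ir.
  have := indX (i :: r) (fun j => if j == i then B else B' j) urr.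
  have := indX r B' ur mB'; move=> ->.
  rewrite big_cons eqxx muleC => h.
  rewrite (_ : _ `&` _ =
    [set w | forall j, j \in i :: r -> (if j == i then B else B' j) (X j w)]).
    rewrite h; last by move=> j; case: ifP.
    congr (_ * _)%E; apply: eq_big_seq => j jr.
    by case: eqP => // ji; rewrite -ji jr in ir.
  apply/seteqP; split => w /=.
    move=> [h1 h2] j; rewrite inE; case: eqP => [->//|_ /=]; exact: h1.
  move=> h'; split => [j jr|]; last by have := h' i; rewrite eqxx inE eqxx; exact.
  have := h' j; rewrite inE jr orbT => /(_ isT).
  by case: eqP => [ji|//]; rewrite -ji jr in ir.
Qed.

End Cylinders.

(** By Fubini's theorem, W being integrated out first. The integrand is clipped to
    [0, 1] so that c times it is the uniform mass of ]-oo, c y[ for every real y,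
    and not only for the values of Y. *)
Lemma uniform_lt_prob (Y W : {RV P >-> R}) (c : R) :
  (forall w, 0 <= Y w <= 1) -> is_uniform01 W ->
  (forall A1 A2, measurable A1 -> measurable A2 ->
    P (Y @^-1` A1 `&` W @^-1` A2) = (P (Y @^-1` A1) * P (W @^-1` A2))%E) ->
  0 <= c <= 1 ->
  P [set w | W w < c * Y w] =
  (c%:E * \int[distribution P Y]_y (Num.max 0 (Num.min y 1))%:E)%E.
Proof.
move=> Y01 uW indYW /andP[c0 c1].
have mYW : measurable_fun setT (fun w => (Y w, W w)) by exact: measurable_fun_pair.
pose clip (y : R) : R := Num.max 0 (Num.min y 1).
have mclip : measurable_fun setT clip.
  by apply: measurable_maxr => //; exact: measurable_minr.
have clip01 y : 0 <= clip y <= 1.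
  by rewrite /clip le_max lexx/= ge_max ler01 ge_min lexx orbT.
pose E := [set z : R * R | z.2 < c * clip z.1].
have mE : measurable E.
  have : measurable_fun setT (fun z : R * R => z.2 < c * clip z.1).
    apply: measurable_fun_ltr => //; apply: measurable_funM => //.
    by apply: measurableT_comp => //; exact: measurable_fst.
  by move=> /(_ measurableT [set true]); rewrite setTI; exact.
rewrite (_ : [set w | _] = (fun w => (Y w, W w)) @^-1` E); last first.
  apply/seteqP; split => w; rewrite /E/= /clip; have /andP[Y0 Y1] := Y01 w.
    by rewrite min_l// max_r.
  by rewrite min_l// max_r.
pose YW : {mfun T >-> (R * R)%type} :=
  HB.pack (fun w => (Y w, W w)) (isMeasurableFun.Build _ _ _ _ _ mYW).
transitivity (distribution P YW E) => //.
rewrite -(@product_measure_unique _ _ _ _ _ (distribution P Y) (distribution P W))//.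
rewrite /product_measure1/= -ge0_integralZl//; last 2 first.
  exact/measurable_EFinP.
  by move=> y _; rewrite lee_fin; have /andP[] := clip01 y.
apply: eq_integral => y _.
rewrite (_ : xsection E y = [set r | r < c * clip y]); last first.
  by apply/seteqP; split => r; rewrite /xsection/= inE.
have /andP[cl0 cl1] := clip01 y.
rewrite /= uW; last exact: measurable_lt_set.
by rewrite uniform01_lt// mulr_ge0//= mulr_ile1.
Qed.

(** The sample space with the sigma-algebra of the inputs in S: a map that is
    measurable on this type is a function of these inputs. *)
Definition past (I : eqType) (X : I -> {RV P >-> R}) (S : pred I) :=
  g_sigma_algebraType (cylinder X S).

Section Past.
Variables (I : eqType) (X : I -> {RV P >-> R}).

Lemma past_measurable S (A : set T) : measurable (A : set (past X S)) ->
  measurable A.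
Proof. exact: sigma_cylinder_measurable. Qed.

Lemma past_measurable_fun S d' (T' : sigmaRingType d') (f : T -> T') :
  measurable_fun setT (f : past X S -> T') -> measurable_fun setT f.
Proof.
by move=> mf _ A mA; apply: (@past_measurable S); exact: mf.
Qed.

Lemma measurable_fun_input (S : pred I) i : S i ->
  measurable_fun setT (X i : past X S -> R).
Proof.
move=> Si _ A mA; rewrite setTI; apply: sub_sigma_algebra.
exists [:: i], (fun=> A); split => //=; first by rewrite Si.
apply/seteqP; split => w /=; first by move=> Aw j; rewrite inE => /eqP ->.
by apply; rewrite inE.
Qed.

Lemma past_sub (S S' : pred I) (A : set T) : {subset S <= S'} ->
  measurable (A : set (past X S)) -> measurable (A : set (past X S')).
Proof.
move=> SS'; apply: sub_sigma_algebra2 => _ [r [C [ur rS mC ->]]].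
by exists r, C; split => //; apply: sub_all rS => i; exact: SS'.
Qed.

Lemma past_sub_fun (S S' : pred I) d' (T' : sigmaRingType d') (f : T -> T') :
  {subset S <= S'} ->
  measurable_fun setT (f : past X S -> T') ->
  measurable_fun setT (f : past X S' -> T').
Proof. by move=> SS' mf _ A mA; apply: (past_sub SS'); exact: mf. Qed.

(** The memorylessness of the exponential law, on the uniform scale: given
    W < Y, the ratio W / Y is again uniform. *)
Lemma uniform_memoryless (S : pred I) i (B : set T) (Y : T -> R) (c : R) :
  mutually_independent X -> is_uniform01 (X i) -> ~~ S i ->
  measurable (B : set (past X S)) ->
  measurable_fun setT (Y : past X S -> R) ->
  (forall w, 0 <= Y w <= 1) -> 0 <= c <= 1 ->
  P (B `&` [set w | X i w < c * Y w]) =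
  (c%:E * P (B `&` [set w | (X i w < Y w)%R]))%E.
Proof.
move=> indX uX Si mB mY Y01 c01.
(* W < YB differs from the event W < Y inside B by the null event W < 0. *)
pose YB (w : T) : R := if w \in B then Y w else 0.
have mYB' : measurable_fun setT (YB : past X S -> R).
  apply: measurable_fun_ifT => //.
  apply: (measurable_fun_bool true); rewrite setTI.
  rewrite (_ : _ @^-1` _ = B)//.
  by apply/seteqP; split => w /=; [exact: set_mem|exact: mem_set].
have mYB : measurable_fun setT YB by exact: past_measurable_fun mYB'.
pose YB' : {RV P >-> R} := HB.pack YB (isMeasurableFun.Build _ _ _ _ _ mYB).
have mXlt0 : measurable [set w | X i w < 0].
  have : measurable_fun setT (fun w => X i w < 0) by exact: measurable_fun_ltr.
  by move=> /(_ measurableT [set true]); rewrite setTI; exact.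
have X0 : P [set w | X i w < 0] = 0%E.
  have := uX [set r | r < 0] (measurable_lt_set 0).
  by rewrite uniform01_lt ?lexx ?ler01.
have YBP a : 0 <= a <= 1 -> P (B `&` [set w | X i w < a * Y w]) =
    (a%:E * \int[distribution P YB']_y (Num.max 0 (Num.min y 1))%:E)%E.
  move=> a01; rewrite -(@uniform_lt_prob _ (X i))//; last 2 first.
  - by move=> w; rewrite /= /YB; case: ifP => // _; rewrite lexx ler01.
  - move=> A1 A2 mA1 mA2; apply: independent_past Si _ mA2 => //.
    by have := mYB' measurableT _ mA1; rewrite setTI.
  rewrite (_ : [set w | _ < a * YB' w] = (B `&` [set w | X i w < a * Y w]) `|`
      (~` B `&` [set w | X i w < 0])).
    rewrite measureU0//.
    + apply: measurableI; first exact: past_measurable mB.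
      have : measurable_fun setT (fun w => X i w < a * Y w).
        apply: measurable_fun_ltr => //; apply: measurable_funM => //.
        exact: past_measurable_fun mY.
      by move=> /(_ measurableT [set true]); rewrite setTI; exact.
    + apply: measurableI; first by apply: measurableC; exact: past_measurable mB.
      exact: mXlt0.
    + apply/eqP; rewrite eq_le measure_ge0 andbT -X0.
      apply: measureIr => //.
      by apply: measurableC; exact: past_measurable mB.
  apply/seteqP; split => w /=; rewrite /YB.
    case: ifPn => [/set_mem Bw XY|/negP]; first by left.
    rewrite inE mulr0 => Bw XY; by right.
  move=> [[Bw XY]|[Bw XY]]; first by rewrite mem_set.
  by rewrite memNset// mulr0.
rewrite YBP//; have := YBP 1; rewrite lexx ler01 mul1e => <-//.
by under eq_set do rewrite mul1r.
Qed.

End Past.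

End Independence.

(** * Inverse transform sampling *)

Section Slots.
Variables (R : realType).

Lemma at_label_ord p (f : 'I_p -> R) (i : 'I_p) : at_label f i.+1 = f i.
Proof.
rewrite /at_label (bigD1 i)//= big1 ?addr0// => j /andP[/eqP/eqP].
by rewrite eqSS => /eqP/val_inj ->; rewrite eqxx.
Qed.

Lemma at_label_eq0 p (f : 'I_p -> R) z :
  (forall i : 'I_p, z != i.+1) -> at_label f z = 0.
Proof. by move=> zi; rewrite /at_label big1// => i; rewrite eq_sym (negbTE (zi i)). Qed.

Lemma labelP p z : (exists i : 'I_p, z = i.+1) \/ (forall i : 'I_p, z != i.+1).
Proof.
have [[i zi]|zi] := pselect (exists i : 'I_p, z = i.+1); first by left; exists i.
by right => i; apply/eqP => zE; apply: zi; exists i.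
Qed.

Lemma at_label_ge0 p (f : 'I_p -> R) z : (forall i, 0 <= f i) -> 0 <= at_label f z.
Proof. by move=> f0; rewrite /at_label sumr_ge0. Qed.

Variables (n : nat) (w : 'I_n -> R).
Hypothesis w0 : forall i, 0 <= w i.

Lemma slot_width (k : 'I_n) :
  \sum_(j < n | (j <= k)%N) w j = \sum_(j < n | (j < k)%N) w j + w k.
Proof.
rewrite (bigD1 k)//= addrC; congr (_ + _); apply: eq_bigl => j.
by rewrite ltn_neqAle andbC.
Qed.

Lemma in_slot_inj u (k l : 'I_n) : in_slot w k u -> in_slot w l u -> k = l.
Proof.
have lt_slot (a b : 'I_n) : (a < b)%N -> in_slot w a u -> in_slot w b u -> False.
  move=> ab /andP[_ ua] /andP[bu _].
  suff : u < u by rewrite ltxx.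
  apply: lt_le_trans ua (le_trans _ bu).
  rewrite [leRHS](bigID (fun j : 'I_n => (j <= a)%N))/=.
  rewrite [X in X + _](eq_bigl (fun j : 'I_n => (j <= a)%N)); last first.
    move=> j /=; have [ja|] := leqP j a; last by rewrite andbF.
    by rewrite andbT (leq_ltn_trans ja ab).
  by rewrite lerDl sumr_ge0.
move=> ku lu; apply/val_inj; case: (ltngtP k l) => // kl.
  by case: (lt_slot _ _ kl ku lu).
by case: (lt_slot _ _ kl lu ku).
Qed.

Lemma select_slot u (k : 'I_n) : in_slot w k u -> select w u = k.+1.
Proof.
move=> ku; rewrite /select (bigD1 k)//= ku muln1 big1 ?addn0// => l lk.
case: (boolP (in_slot w l u)) => [lu|]; last by rewrite muln0.
by rewrite (in_slot_inj lu ku) eqxx in lk.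
Qed.

Lemma select_eq u (k : 'I_n) : (select w u == k.+1) = in_slot w k u.
Proof.
apply/idP/idP => [/eqP|/select_slot->//].
have [[l lu]|nl] := pselect (exists l, in_slot w l u).
  by rewrite (select_slot lu) => -[/val_inj <-].
rewrite /select big1// => l _; case: (boolP (in_slot w l u)); rewrite ?muln0// => lu.
by case: nl; exists l.
Qed.

Lemma uniform_slot (k : 'I_n) : \sum_j w j <= 1 ->
  uniform_prob (@ltr01 R) [set u | in_slot w k u] = (w k)%:E.
Proof.
move=> w1; rewrite /in_slot uniform01_itvco ?sumr_ge0//.
- by rewrite slot_width addrAC subrr add0r.
- by rewrite slot_width lerDl.
- apply: le_trans w1; rewrite [leRHS](bigID (fun j : 'I_n => (j <= k)%N))/=.
  by rewrite lerDl sumr_ge0.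
Qed.

End Slots.

Lemma select0 (R : realType) n (u : R) : select (fun _ : 'I_n => 0) u = 0%N.
Proof.
rewrite /select big1// => k _; rewrite /in_slot !big1//.
by case: (boolP (0 <= u < 0)) => [/andP[/le_lt_trans h /h]|]; rewrite ?ltxx ?muln0.
Qed.

(** * Measurable functions of discrete variables *)

Section DiscreteMeasurability.
Context d (T : measurableType d).

Lemma measurable_of_nat d' (T' : measurableType d') (f : nat -> T') (z : T -> nat) :
  measurable_fun setT z -> measurable_fun setT (fun w => f (z w)).
Proof. by move=> mz; apply: measurableT_comp. Qed.

Lemma measurable_of_bool d' (T' : measurableType d') (f : bool -> T') (z : T -> bool) :
  measurable_fun setT z -> measurable_fun setT (fun w => f (z w)).
Proof. by move=> mz; apply: measurableT_comp. Qed.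

Lemma measurable_set_of_bool (b : T -> bool) :
  measurable_fun setT b -> measurable [set w | b w].
Proof. by move=> /(_ measurableT [set true]); rewrite setTI; exact. Qed.

Lemma measurable_bool_of_set (b : T -> bool) :
  measurable [set w | b w] -> measurable_fun setT b.
Proof. by move=> mb; apply: (measurable_fun_bool true); rewrite setTI. Qed.

Lemma measurable_nat_index d1 (T1 : measurableType d1) d' (T' : measurableType d')
    (F : nat -> T1 -> T') (z : T -> nat) (v : T -> T1) :
  (forall k, measurable_fun setT (F k)) -> measurable_fun setT z ->
  measurable_fun setT v -> measurable_fun setT (fun w => F (z w) (v w)).
Proof.
move=> mF mz mv _ A mA; rewrite setTI.
rewrite (_ : _ @^-1` _ = \bigcup_k (z @^-1` [set k] `&` (fun w => F k (v w)) @^-1` A)).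
  apply: bigcup_measurable => k _; apply: measurableI.
    by rewrite -[X in measurable X]setTI; exact: mz.
  rewrite -[X in measurable X]setTI.
  exact: (measurableT_comp (mF k) mv).
apply/seteqP; split => w /=; first by move=> Aw; exists (z w).
by move=> [k _ [/= ->]].
Qed.

Lemma measurable_sumn (I : Type) (s : seq I) (F : I -> T -> nat) :
  (forall i, measurable_fun setT (F i)) ->
  measurable_fun setT (fun w => \sum_(i <- s) F i w)%N.
Proof.
move=> mF; elim: s => [|i s IH].
  by under eq_fun do rewrite big_nil; exact: measurable_cst.
by under eq_fun do rewrite big_cons; exact: measurable_fun_addn.
Qed.

Lemma measurable_lne_EFin (R : realType) (f : T -> R) : measurable_fun setT f ->
  measurable_fun setT (fun w => lne (f w)%:E).
Proof.
move=> mf.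
have -> : (fun w => lne (f w)%:E) =
    fun w => if 0 < f w then (ln (f w))%:E else -oo%E.
  apply/funext => w; case: ltP => f0; first by rewrite lne_EFin.
  by rewrite le0_lneNy.
apply: measurable_fun_ifT; first exact: measurable_fun_ltr.
  by apply/measurable_EFinP; exact: (measurableT_comp (@measurable_ln R)).
exact: measurable_cst.
Qed.

End DiscreteMeasurability.

Lemma measurable_in_slot (R : realType) n (w : 'I_n -> R) k :
  measurable_fun setT (fun u => in_slot w k u).
Proof. by apply: measurable_and; [exact: measurable_fun_ler|exact: measurable_fun_ltr]. Qed.

Lemma measurable_select (R : realType) n (w : 'I_n -> R) :
  measurable_fun setT (select w).
Proof.
apply: measurable_sumn => k.
by apply: (measurable_of_bool (fun b : bool => k.+1 * b)%N); exact: measurable_in_slot.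
Qed.

(** * Paths with prescribed states and jump times *)

Section JumpPath.
Variables (R : realType).

Let occ (z : nat -> nat) (tau : nat -> \bar R) (t : R) n : R :=
  (z n)%:R * (tau n <= t%:E < tau n.+1)%E%:R.

Lemma jump_path_stop (z : nat -> nat) (tau : nat -> \bar R) t N :
  (forall k, (N <= k)%N -> ~~ (tau k <= t%:E < tau k.+1)%E) ->
  jump_path z tau t = \sum_(k < N) occ z tau t k.
Proof.
move=> hN; apply: lim_near_cst => //; near=> n.
have Nn : (N <= n)%N by near: n; exact: nbhs_infty_ge.
rewrite /series/= (big_cat_nat _ Nn)//= big_mkord.
rewrite [X in _ + X = _]big_nat [X in _ + X = _]big1 ?addr0//.
by move=> k /andP[Nk _]; rewrite (negbTE (hN k Nk)) mulr0.
Unshelve. all: by end_near. Qed.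

(** What the first n jumps say of the path, if no further jump occurs. *)
Definition truncated_path (z : nat -> nat) (tau : nat -> \bar R) n (t : R) : R :=
  \sum_(k < n) (z k)%:R * (tau k <= t%:E < tau k.+1)%E%:R +
  (z n)%:R * (tau n <= t%:E)%E%:R.

Lemma jump_path_truncated (z : nat -> nat) (tau : nat -> \bar R) n t u :
  nondecreasing_seq tau -> t <= u -> (u%:E < tau n.+1)%E ->
  jump_path z tau t = truncated_path z tau n t.
Proof.
move=> ndtau tu un; have tn : (t%:E < tau n.+1)%E.
  by rewrite (le_lt_trans _ un)// lee_fin.
rewrite (@jump_path_stop _ _ _ n.+1) => [|k nk]; last first.
  by rewrite negb_and -ltNge (lt_le_trans tn)// ndtau.
by rewrite big_ord_recr/= /truncated_path /occ tn andbT.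
Qed.

Lemma jump_path_at (z : nat -> nat) (tau : nat -> \bar R) n t :
  nondecreasing_seq tau -> (tau n <= t%:E < tau n.+1)%E ->
  jump_path z tau t = (z n)%:R.
Proof.
move=> ndtau /andP[nt tn]; rewrite (@jump_path_truncated _ _ n t t)//.
rewrite /truncated_path nt mulr1 big1 ?add0r// => k _.
by rewrite ltNge (le_trans (ndtau _ _ (ltn_ord k)) nt) andbF mulr0.
Qed.

Lemma jump_path_out (z : nat -> nat) (tau : nat -> \bar R) t :
  (forall n, ~~ (tau n <= t%:E < tau n.+1)%E) -> jump_path z tau t = 0.
Proof. by move=> h; rewrite (@jump_path_stop _ _ _ 0)// big_ord0. Qed.

(** The terms of the series are natural numbers: it converges exactly where they
    eventually vanish, and the limit operator has a fixed value elsewhere. Hence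
    measurability holds without any assumption on the jump times. *)
Lemma measurable_jump_path d (T : measurableType d) (z : nat -> T -> nat)
    (tau : nat -> T -> \bar R) t :
  (forall n, measurable_fun setT (z n)) -> (forall n, measurable_fun setT (tau n)) ->
  measurable_fun setT (fun w => jump_path (z^~ w) (tau^~ w) t).
Proof.
move=> mz mtau.
pose f n w := occ (z^~ w) (tau^~ w) t n.
have mf n : measurable_fun setT (f n).
  apply: measurable_funM; first exact: (measurable_of_nat (fun k => k%:R : R)).
  apply: (measurable_of_bool (fun b : bool => b%:R : R)).
  by apply: measurable_and; [exact: measurable_fun_lee|exact: measurable_fun_lte].
pose C := \bigcup_N \bigcap_(n in [set n | (N <= n)%N]) [set w | f n w == 0].
have mC : measurable C.
  apply: bigcup_measurable => N _; apply: bigcap_measurable => [|n _].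
    by exists N => /=.
  by apply: measurable_set_of_bool; exact: measurable_fun_eqr.
pose g w := limn (series (fun n => if w \in C then f n w else 0)).
have mCb : measurable_fun setT (fun w => w \in C).
  apply: measurable_bool_of_set; rewrite (_ : [set w | _] = C)//.
  by apply/seteqP; split => w /=; [exact: set_mem|exact: mem_set].
have mg : measurable_fun setT g.
  apply: (measurable_fun_cvg
    (h := fun n w => series (fun n => if w \in C then f n w else 0) n)).
    move=> n; apply: measurable_sum => k.
    by apply: measurable_fun_ifT.
  move=> w _; rewrite /g; have [wC|_] := boolP (w \in C); last first.
    apply/cvg_ex; exists (0 : R); apply: cvg_near_cst; near=> n.
    by rewrite /series/= big1.
  have [N _ NC] := set_mem wC.
  apply/cvg_ex; exists (series (f^~ w) N); apply: cvg_near_cst; near=> n.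
  have Nn : (N <= n)%N by near: n; exact: nbhs_infty_ge.
  rewrite /series/= (big_cat_nat _ Nn)//= [X in _ + X = _]big_nat.
  by rewrite [X in _ + X = _]big1 ?addr0// => k /andP[Nk _]; apply/eqP; exact: NC.
have -> : (fun w => jump_path (z^~ w) (tau^~ w) t) =
    (fun w => if w \in C then g w else point).
  apply/funext => w; case: ifPn => wC.
    by rewrite /g wC.
  apply: dvgP => /cvg_series_cvg_0/cvgrPdist_lt/(_ 1 ltr01)[N _ hN].
  move: wC => /negP; apply; apply/mem_set; exists N => // n /= Nn.
  have := hN n Nn; rewrite sub0r normrN /f /occ -natrM normr_nat.
  by rewrite -[X in _ < X]/(1%:R) ltr_nat ltnS leqn0 => /eqP ->.
exact: measurable_fun_ifT.
Unshelve. all: by end_near. Qed.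

End JumpPath.

(** * Jump times within one regime *)

Section RegimeDefinitions.
Variables (R : realType) (p : nat) (Q : 'M[R]_p).

Definition jump_rate (z : nat) : R := at_label (fun i => - Q i i) z.

Fixpoint regime_time (z : nat -> nat) (w : nat -> R) (n : nat) : \bar R :=
  if n is n'.+1 then
    (regime_time z w n' - lne (w n')%:E / (jump_rate (z n'))%:E)%E
  else 0%E.

End RegimeDefinitions.

Section Regime.
Variables (R : realType) (p M : nat).

Lemma jump_time_regime (Q : 'I_M -> 'M[R]_p) (m : 'I_M) z w n :
  jump_time Q m.+1 z w n = regime_time (Q m) z w n.
Proof.
elim: n => //= n ->; congr (_ - _)%E.
rewrite (bigD1 m)//= eqxx mul1e big1 ?adde0// => k km.
by rewrite eqSS -[_ == _ :> nat]/(m == k) eq_sym (negbTE km) mul0e.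
Qed.

Lemma mixture_chain_regime (Pi : 'I_M -> 'M[R]_p) (m : 'I_M) z0 v n :
  mixture_chain Pi m.+1 z0 v n = regime_chain (Pi m) z0 v n.
Proof.
elim: n => //= n ->; rewrite /select; apply: eq_bigr => k _.
rewrite (bigD1 m)//= eqxx muln1 big1 ?addn0// => l lm.
by rewrite eqSS -[_ == _ :> nat]/(m == l) eq_sym (negbTE lm) muln0.
Qed.

Variable Q : 'M[R]_p.
Hypothesis iQ : is_intensity Q.

Lemma jump_rate_ge0 z : 0 <= jump_rate Q z.
Proof. by apply: at_label_ge0 => i; rewrite oppr_ge0; exact: intensity_diag. Qed.

Lemma jump_matrix_ge0 i j : 0 <= jump_matrix Q i j.
Proof.
rewrite mxE; case: eqP => // /eqP ji; apply: divr_ge0.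
  exact: intensity_offdiag.
by rewrite oppr_ge0; exact: intensity_diag.
Qed.

Lemma rate_jump_matrix i j : - Q i i * jump_matrix Q i j = if j == i then 0 else Q i j.
Proof.
rewrite mxE; case: eqP => [_|/eqP ji]; first by rewrite mulr0.
have [Qi0|Qi0] := eqVneq (- Q i i) 0; last by rewrite mulrC divfK.
rewrite Qi0 mul0r; apply/esym/eqP; have := intensity_row iQ i.
rewrite Qi0 => /eqP; rewrite psumr_eq0 => [/allP/(_ j)|k ki]; last exact: intensity_offdiag.
by rewrite mem_index_enum ji => /(_ isT).
Qed.

Lemma jump_matrix_row i : \sum_j jump_matrix Q i j <= 1.
Proof.
have [Qi0|Qi0] := eqVneq (- Q i i) 0.
  rewrite big1// => j _; rewrite mxE Qi0 invr0 mulr0; by case: eqP.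
rewrite (bigD1 i)//= mxE eqxx add0r (eq_bigr (fun j => Q i j / - Q i i)).
  by rewrite -mulr_suml (intensity_row iQ) divff.
by move=> j ji; rewrite mxE (negbTE ji).
Qed.

Section Pathwise.
Variables (z : nat -> nat) (w : nat -> R).
Hypothesis w01 : forall n, 0 < w n < 1.

Let tau := regime_time Q z w.

Let increment n : \bar R := (- (lne (w n)%:E / (jump_rate Q (z n))%:E))%E.

Let incrementE n : increment n =
  if jump_rate Q (z n) == 0 then +oo%E else (- ln (w n) / jump_rate Q (z n))%:E.
Proof.
have /andP[w0 w1] := w01 n; have lnw : ln (w n) < 0 by exact: ln_lt0.
rewrite /increment lne_EFin// inver; case: ifPn => r0; last by rewrite -EFinM -EFinN mulNr.
by rewrite lt0_muley.
Qed.

Let increment_ge0 n : (0 <= increment n)%E.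
Proof.
rewrite incrementE; case: ifPn => // _; rewrite lee_fin divr_ge0 ?jump_rate_ge0//.
by rewrite oppr_ge0 ltW// ln_lt0.
Qed.

Lemma regime_time_ge0 n : (0 <= tau n)%E.
Proof.
elim: n => [//|n IH]; rewrite /tau/= -/(tau n) -/(increment n).
by rewrite adde_ge0.
Qed.

Lemma regime_time_nondecreasing : nondecreasing_seq tau.
Proof.
apply/nondecreasing_seqP => n; rewrite {2}/tau/= -/(tau n) -/(increment n).
by rewrite leeDl.
Qed.

(** On the uniform scale, the sojourn exceeds u - a when w n is below an exponential.
    This form covers absorbing states too: their rate is 0, the next jump time is
    +oo, and the right-hand side reads w n < 1. *)
Lemma lt_regime_timeS n (u a : R) : tau n = a%:E ->
  (u%:E < tau n.+1)%E = (w n < expR (- (jump_rate Q (z n) * (u - a)))).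
Proof.
have /andP[w0 w1] := w01 n => na; rewrite {1}/tau/= -/(tau n) -/(increment n) na.
rewrite incrementE; case: eqVneq => [->|r0].
  by rewrite addey// ltry mul0r oppr0 expR0 w1.
have r_gt0 : 0 < jump_rate Q (z n) by rewrite lt_def r0 jump_rate_ge0.
rewrite -EFinD lte_fin -ltrBlDl ltr_pdivlMr// ltrNr -[RHS]ltr_ln ?posrE ?expR_gt0//.
by rewrite expRK mulrC.
Qed.

(** A jump that follows another one within time e needs a uniform variable close
    to 1; K bounds the rates. *)
Lemma lt_regime_timeS_rate n (u e K : R) : 0 <= e -> jump_rate Q (z n) <= K ->
  (u%:E < tau n)%E -> w n < expR (- (K * e)) -> ((u + e)%:E < tau n.+1)%E.
Proof.
have /andP[w0 w1] := w01 n => e0 rK un wK.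
have : (e%:E <= increment n)%E.
  rewrite incrementE; case: ifPn => [_|r0]; first by rewrite leey.
  have r_gt0 : 0 < jump_rate Q (z n) by rewrite lt_def r0 jump_rate_ge0.
  rewrite lee_fin ler_pdivlMr// mulrC (le_trans (ler_wpM2r e0 rK))//.
  rewrite -lerNr ltW// -ltr_expR lnK//.
rewrite {1}/tau/= -/(tau n) -/(increment n) EFinD => ie.
by rewrite lte_leD.
Qed.

End Pathwise.

End Regime.

Lemma measurable_regime_chain (R : realType) p (Pi : 'M[R]_p) z0 d
    (T : measurableType d) (v : nat -> T -> R) n :
  (forall k, (0 < k <= n)%N -> measurable_fun setT (v k)) ->
  measurable_fun setT (fun w => regime_chain Pi z0 (v^~ w) n).
Proof.
elim: n => [|n IH] mv; first exact: measurable_cst.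
apply: (measurable_nat_index
  (F := fun k => select (fun j => at_label (fun i => Pi i j) k))
  (z := fun w => regime_chain Pi z0 (v^~ w) n) (v := v n.+1)).
- by move=> k; exact: measurable_select.
- by apply: IH => k /andP[k0 kn]; apply: mv; rewrite k0 ltnW.
- by apply: mv; rewrite leqnn.
Qed.

Lemma measurable_regime_time (R : realType) p (Q : 'M[R]_p) d
    (T : measurableType d) (z : nat -> T -> nat) (w : nat -> T -> R) n :
  (forall k, (k < n)%N -> measurable_fun setT (z k) /\ measurable_fun setT (w k)) ->
  measurable_fun setT (fun x => regime_time Q (z^~ x) (w^~ x) n).
Proof.
elim: n => [|n IH] mzw; first exact: measurable_cst.
have [mz mw] := mzw n (ltnSn _).
rewrite /=; apply: emeasurable_funB.
  by apply: IH => k kn; apply: mzw; rewrite ltnW.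
apply: emeasurable_funM; first exact: measurable_lne_EFin.
exact: (measurable_of_nat (fun k => ((jump_rate Q k)%:E)^-1%E)).
Qed.

(** * Probabilities as real numbers *)

Section Prob.
Context d (T : measurableType d) (R : realType) (P : probability T R).

Definition prob (A : set T) : R := fine (P A).

Lemma probE A : measurable A -> P A = (prob A)%:E.
Proof. by move=> mA; rewrite fineK// fin_num_measure. Qed.

Lemma prob_ge0 A : 0 <= prob A.
Proof. exact: fine_ge0. Qed.

Lemma prob0 : prob set0 = 0.
Proof. by rewrite /prob measure0. Qed.

Lemma prob1 : prob setT = 1.
Proof. by rewrite /prob probability_setT. Qed.

Lemma prob_le A B : measurable A -> measurable B -> A `<=` B -> prob A <= prob B.
Proof.
by move=> mA mB AB; rewrite -lee_fin -!probE//; apply: le_measure; rewrite ?inE.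
Qed.

Lemma prob_le1 A : measurable A -> prob A <= 1.
Proof. by move=> mA; rewrite -lee_fin -probE// probability_le1. Qed.

Lemma probU A B : measurable A -> measurable B -> A `&` B = set0 ->
  prob (A `|` B) = prob A + prob B.
Proof.
move=> mA mB AB; apply: EFin_inj; rewrite EFinD -!probE//; last exact: measurableU.
by rewrite measureU.
Qed.

Lemma probD A B : measurable A -> measurable B -> B `<=` A ->
  prob (A `\` B) = prob A - prob B.
Proof.
move=> mA mB BA; apply: EFin_inj; rewrite EFinB -!probE//; last exact: measurableD.
by rewrite measureD ?(setIidr BA)// ltey_eq fin_num_measure.
Qed.

Lemma probU_le A B : measurable A -> measurable B ->
  prob (A `|` B) <= prob A + prob B.
Proof.
move=> mA mB; rewrite -lee_fin EFinD -!probE//; last exact: measurableU.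
exact: measureU2.
Qed.

Lemma prob_split (I : finType) (E : I -> set T) A :
  measurable A -> (forall i, measurable (E i)) ->
  (forall i j w, E i w -> E j w -> i = j) ->
  (forall w, A w -> exists i, E i w) ->
  prob A = \sum_i prob (A `&` E i).
Proof.
move=> mA mE dE cE.
pose U (s : seq I) := [set w | exists2 i, i \in s & E i w].
have US i s : U (i :: s) = E i `|` U s.
  apply/seteqP; split => w.
    by move=> [k]; rewrite inE => /predU1P[->|ks] Ek; [left|right; exists k].
  move=> [Ei|[k ks Ek]]; first by exists i; rewrite ?mem_head.
  by exists k; rewrite // inE ks orbT.
have U0 : U [::] = set0 by apply/seteqP; split => w // [].
have mU s : measurable (U s).
  by elim: s => [|i s IH]; rewrite ?U0// US; exact: measurableU.
rewrite {1}(_ : A = A `&` U (index_enum I)); last first.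
  apply/seteqP; split => [w Aw|w []//]; split => //.
  by have [i Ei] := cE _ Aw; exists i; rewrite ?mem_index_enum.
have : uniq (index_enum I) by exact: index_enum_uniq.
elim: (index_enum I) => [_|i s IH /= /andP[iNs us]].
  by rewrite big_nil U0 setI0 prob0.
rewrite big_cons -IH// US setIUr probU//.
- exact: measurableI.
- exact: measurableI.
- apply/seteqP; split => w // [[_ Ei] [_ [k ks Ek]]].
  by move: iNs; rewrite (dE _ _ _ Ei Ek) ks.
Qed.

Section OnFullSet.
Variable G : set T.
Hypotheses (mG : measurable G) (G1 : P (~` G) = 0%E).

Lemma prob_setI A : measurable A -> prob (A `&` G) = prob A.
Proof.
move=> mA; have AE : A = (A `&` G) `|` (A `&` ~` G) by rewrite -setIUr setUv setIT.
rewrite [in RHS]AE /prob measureU0//.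
- exact: measurableI.
- by apply: measurableI => //; exact: measurableC.
- apply/eqP; rewrite eq_le measure_ge0 andbT -G1; apply: measureIr => //.
  exact: measurableC.
Qed.

Lemma prob_le_on A B : measurable A -> measurable B -> A `&` G `<=` B ->
  prob A <= prob B.
Proof.
move=> mA mB AB; rewrite -(prob_setI mA); apply: prob_le => //.
exact: measurableI.
Qed.

Lemma prob_eq_on A B : measurable A -> measurable B ->
  (forall w, G w -> A w <-> B w) -> prob A = prob B.
Proof.
move=> mA mB AB; rewrite -(prob_setI mA) -(prob_setI mB); congr prob.
by apply/seteqP; split => w [? Gw]; split => //; apply/(AB w Gw).
Qed.

End OnFullSet.

Lemma prob_bigcup_le (C : nat -> set T) (H : set T) (b : R) :
  (forall n, measurable (C n)) -> trivIset setT C -> measurable H ->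
  (forall n, prob (C n `&` H) <= b * prob (C n)) ->
  prob (\bigcup_n C n `&` H) <= b * prob (\bigcup_n C n).
Proof.
move=> mC tC mH CH; have mCH n : measurable (C n `&` H) by exact: measurableI.
have mUC : measurable (\bigcup_n C n) by exact: bigcup_measurable.
rewrite -lee_fin EFinM -!probE//; last exact: measurableI.
rewrite setI_bigcupl !measure_semi_bigcup//; last 2 first.
- by apply: trivIset_setIr.
- exact: bigcup_measurable.
rewrite -nneseriesZl; last by move=> i _; exact: measure_ge0.
apply: lee_nneseries => [i _ _|n _]; first exact: measure_ge0.
by have := CH n; rewrite -lee_fin EFinM -!probE.
Qed.

Lemma prob_bigcup_ge (C : nat -> set T) (H : set T) (a : R) :
  (forall n, measurable (C n)) -> trivIset setT C -> measurable H ->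
  (forall n, a * prob (C n) <= prob (C n `&` H)) ->
  a * prob (\bigcup_n C n) <= prob (\bigcup_n C n `&` H).
Proof.
move=> mC tC mH CH; have mCH n : measurable (C n `&` H) by exact: measurableI.
have [a0|a0] := ltP a 0.
  by rewrite (@le_trans _ _ 0) ?prob_ge0// mulr_le0_ge0// ?prob_ge0// ltW.
have mUC : measurable (\bigcup_n C n) by exact: bigcup_measurable.
rewrite -lee_fin EFinM -!probE//; last exact: measurableI.
rewrite setI_bigcupl !measure_semi_bigcup//; last 2 first.
- by apply: trivIset_setIr.
- exact: bigcup_measurable.
rewrite -nneseriesZl; last by move=> i _; exact: measure_ge0.
apply: lee_nneseries => [i _ _|n _].
  by rewrite mule_ge0// lee_fin.
by have := CH n; rewrite -lee_fin EFinM -!probE.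
Qed.

Section PastReal.
Variables (I : eqType) (X : I -> {RV P >-> R}) (S : pred I) (i : I).
Hypotheses (indX : mutually_independent X) (uX : is_uniform01 (X i)) (Si : ~~ S i).

Lemma prob_independent (A : set T) (B : set R) (b : R) :
  measurable (A : set (past X S)) -> measurable B ->
  uniform_prob (@ltr01 R) B = b%:E ->
  prob (A `&` X i @^-1` B) = b * prob A.
Proof.
move=> mA mB Bb; have PB : P (X i @^-1` B) = b%:E by rewrite -Bb; exact: uX.
apply: EFin_inj; rewrite EFinM -!probE//; last 2 first.
- exact: past_measurable mA.
- apply: measurableI; first exact: past_measurable mA.
  by rewrite -[X in measurable X]setTI; exact: measurable_funP.
by rewrite (independent_past indX Si)// PB muleC.
Qed.

Lemma prob_memoryless (B : set T) (Y : T -> R) (c : R) :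
  measurable (B : set (past X S)) ->
  measurable_fun setT (Y : past X S -> R) ->
  (forall w, 0 <= Y w <= 1) -> 0 <= c <= 1 ->
  prob (B `&` [set w | X i w < c * Y w]) =
  c * prob (B `&` [set w | X i w < Y w]).
Proof.
move=> mB mY Y01 c01; have mY' := past_measurable_fun mY.
have mB' := past_measurable mB.
apply: EFin_inj; rewrite EFinM -!probE ?(uniform_memoryless indX uX Si)//.
- apply: measurableI => //; apply: measurable_set_of_bool.
  exact: measurable_fun_ltr.
- apply: measurableI => //; apply: measurable_set_of_bool.
  by apply: measurable_fun_ltr => //; exact: measurable_funM.
Qed.

End PastReal.

End Prob.

(** * The law of the path within one regime *)

(** The order in which the construction reads its inputs: W_n decides when the n-th
    state is left, then V_(n+1) decides which state follows. *)
Definition input_rank (k : bool + (nat + nat)) : nat :=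
  match k with
  | inl _ => 0
  | inr (inl n) => n.*2.+2
  | inr (inr n) => n.*2.+1
  end.

Section RegimeLaw.
Context (R : realType) (p : nat) (Q : 'M[R]_p) (i0 : 'I_p).
Context d (T : measurableType d) (P : probability T R).
Variables (U0 U : {RV P >-> R}) (V W : nat -> {RV P >-> R}).
Hypothesis iQ : is_intensity Q.
Hypothesis hunif : forall k, is_uniform01 (inputs U0 U V W k).
Hypothesis hindep : mutually_independent (inputs U0 U V W).

Notation history m := (past (inputs U0 U V W) (fun k => input_rank k < m)%N).
Notation prob := (prob P).

Definition regime_state n (w : T) : nat :=
  regime_chain (jump_matrix Q) i0.+1 (fun k => V k w) n.
Notation Z := regime_state.

Definition regime_jump n (w : T) : \bar R :=
  regime_time Q (Z^~ w) (fun k => W k w) n.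
Notation tau := regime_jump.

Definition regime_path t (w : T) : R := jump_path (Z^~ w) (tau^~ w) t.
Notation X := regime_path.

Lemma measurable_V m k : (0 < k)%N -> (k.*2 < m)%N ->
  measurable_fun setT (V k : history m -> R).
Proof.
case: k => // k _ km.
exact: (@measurable_fun_input _ _ _ _ _ (inputs U0 U V W) _ (inr (inl k))).
Qed.

Lemma measurable_W m k : (k.*2.+1 < m)%N ->
  measurable_fun setT (W k : history m -> R).
Proof.
move=> km.
exact: (@measurable_fun_input _ _ _ _ _ (inputs U0 U V W) _ (inr (inr k))).
Qed.

Lemma measurable_state m n : (n.*2 < m)%N ->
  measurable_fun setT (Z n : history m -> nat).
Proof.
move=> nm; apply: measurable_regime_chain => k /andP[k0 kn].
by apply: measurable_V => //; rewrite (leq_ltn_trans _ nm)// leq_double.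
Qed.

Lemma measurable_jump m n : (n.*2 <= m)%N ->
  measurable_fun setT (tau n : history m -> \bar R).
Proof.
move=> nm; apply: (@measurable_regime_time _ _ Q _ (history m) Z (fun k => W k)) => k kn; split.
  by apply: measurable_state; rewrite (leq_trans _ nm)// ltn_double.
by apply: measurable_W; rewrite (leq_trans _ nm)// -doubleS leq_double.
Qed.

Definition regular : set T := [set w | forall n, 0 < W n w < 1].

Lemma measurable_regular : measurable regular.
Proof.
rewrite (_ : regular = \bigcap_n [set w | 0 < W n w < 1]).
  apply: bigcapT_measurable => n; apply: measurable_set_of_bool.
  by apply: measurable_and; exact: measurable_fun_ltr.
by apply/seteqP; split => w /= h n; [move=> _|]; exact: h.
Qed.

Lemma regular_full : P (~` regular) = 0%E.
Proof.
apply/(negligibleP _ (measurableC measurable_regular)).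
rewrite (_ : ~` regular = \bigcup_n (W n @^-1` [set r | ~~ (0 < r < 1)])).
  apply: negligible_bigcup => n.
  have mB : measurable [set r : R | ~~ (0 < r < 1)].
    apply: measurable_set_of_bool; apply: measurable_neg.
    by apply: measurable_and; exact: measurable_fun_ltr.
  suff W0 : P (W n @^-1` [set r | ~~ (0 < r < 1)]) = 0%E.
    apply/negligibleP => //.
    by rewrite -[X in measurable X]setTI; exact: measurable_funP.
  transitivity (uniform_prob (@ltr01 R) [set r | ~~ (0 < r < 1)]).
    exact: (hunif (inr (inr n))).
  rewrite uniform01_lebesgue//.
  apply/eqP; rewrite eq_le measure_ge0 andbT.
  apply: (@le_trans _ _ (lebesgue_measure ([set 0] `|` [set 1] : set R))).
    apply: le_measure; rewrite ?inE.
    - by apply: measurableI => //; exact: measurable_itv.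
    - by apply: measurableU; exact: measurable_set1.
    - move=> r [/= /negP r01]; rewrite in_itv/= => /andP[r0 r1].
      have [->|r0'] := eqVneq r 0; first by left.
      right; apply/eqP; case: eqVneq => // r1'.
      by exfalso; apply: r01; rewrite !lt_def r0 r0' r1 eq_sym r1'.
  apply: (@le_trans _ _ (lebesgue_measure [set 0%R : R] +
      lebesgue_measure [set 1%R : R])%E); first exact: measureU2.
  by rewrite !lebesgue_measure_set1 adde0.
apply/seteqP; split => w /=.
  by move=> /existsNP[n /negP]; exists n.
by move=> [n _ /negP h]; apply/existsNP; exists n.
Qed.

Lemma measurable_path t : measurable_fun setT (X t).
Proof.
apply: measurable_jump_path => n.
  by apply: (past_measurable_fun (f := Z n)); exact: measurable_state (ltnSn _).
by apply: (past_measurable_fun (f := tau n)); exact: measurable_jump (leqnn _).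
Qed.

(** Throughout, C0 is the event that the n-th state, entered by time u, is still
    occupied at time u; C1 that it is kept up to time u + e, C2 that it is left
    in between; S is the event that V_(n+1) selects j, and D contains every outcome
    with a second jump by time u + e. *)

Section Step.
Let K : R := \sum_i - Q i i.

Lemma jump_rate_le z : jump_rate Q z <= K.
Proof.
have [[i ->]|zi] := labelP p z.
  rewrite /jump_rate at_label_ord /K (bigD1 i)//= lerDl sumr_ge0// => j _.
  by rewrite oppr_ge0; exact: intensity_diag.
rewrite /jump_rate at_label_eq0// sumr_ge0// => j _.
by rewrite oppr_ge0; exact: intensity_diag.
Qed.

Variables (n : nat) (l j : 'I_p) (u e : R) (B : set T).
Hypothesis e0 : 0 <= e.
Hypothesis mB : measurable (B : set (history n.*2.+1)).
Hypothesis BZ : forall w, B w -> Z n w = l.+1 /\ (tau n w <= u%:E)%E.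

Let q : R := - Q l l.
Let a : R := expR (- (q * e)).
Let b : R := expR (- (K * e)).
Let Y (w : T) : R := expR (- (q * Num.max 0 (u - fine (tau n w)))).
Let C0 := B `&` [set w | W n w < Y w].
Let C1 := B `&` [set w | W n w < a * Y w].
Let C2 := C0 `\` C1.
Let S := [set w | in_slot (fun k => jump_matrix Q l k) j (V n.+1 w)].
Let D := [set w | b <= W n.+1 w].
Let C := B `&` [set w | (u%:E < tau n.+1 w)%E].

Let q_ge0 : 0 <= q.
Proof. by rewrite oppr_ge0; exact: intensity_diag. Qed.

Let qK : q <= K.
Proof. by have := jump_rate_le l.+1; rewrite /jump_rate at_label_ord. Qed.

Let a01 : 0 <= a <= 1.
Proof. by rewrite expR_ge0/= expR_le1 oppr_le0 mulr_ge0. Qed.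

Let b01 : 0 <= b <= 1.
Proof. by rewrite expR_ge0/= expR_le1 oppr_le0 mulr_ge0// (le_trans q_ge0 qK). Qed.

Let Y01 w : 0 <= Y w <= 1.
Proof.
by rewrite expR_ge0/= expR_le1 oppr_le0 mulr_ge0// le_max lexx.
Qed.

Let mY : measurable_fun setT (Y : history n.*2.+1 -> R).
Proof.
apply: measurableT_comp => //; apply: measurableT_comp => //.
apply: measurable_funM => //; apply: measurable_maxr => //.
apply: measurable_funB => //; apply: measurableT_comp => //.
by apply: measurable_jump; exact: leqnSn.
Qed.

Let mY' : measurable_fun setT (Y : history n.*2.+2 -> R).
Proof. by apply: past_sub_fun mY => k; exact: ltnW. Qed.

Let mB' : measurable (B : set (history n.*2.+2)).
Proof. by apply: past_sub mB => k; exact: ltnW. Qed.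

Let mC0 : measurable (C0 : set (history n.*2.+2)).
Proof.
apply: measurableI => //; apply: measurable_set_of_bool.
by apply: measurable_fun_ltr => //; exact: measurable_W.
Qed.

Let mC1 : measurable (C1 : set (history n.*2.+2)).
Proof.
apply: measurableI => //; apply: measurable_set_of_bool.
by apply: measurable_fun_ltr; [exact: measurable_W|exact: measurable_funM].
Qed.

Let mC2 : measurable (C2 : set (history n.*2.+2)).
Proof. exact: measurableD. Qed.

Let mS : measurable (S : set (history n.*2.+3)).
Proof.
apply: measurable_set_of_bool; apply: (measurableT_comp (measurable_in_slot _ _)).
by apply: measurable_V.
Qed.

Let mD : measurable D.
Proof. by apply: measurable_set_of_bool; exact: measurable_fun_ler. Qed.

Let mC : measurable C.
Proof.
apply: measurableI; first exact: past_measurable mB.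
apply: measurable_set_of_bool; apply: measurable_fun_lte => //.
by apply: (past_measurable_fun (f := tau n.+1)); exact: measurable_jump (leqnn _).
Qed.

Let C10 : C1 `<=` C0.
Proof.
move=> w [Bw W1]; split => //; apply: lt_le_trans W1 _.
by rewrite ler_piMl//; have /andP[] := Y01 w; have /andP[] := a01.
Qed.

Let probC1 : prob C1 = a * prob C0.
Proof.
apply: (prob_memoryless hindep (hunif (inr (inr n)))
  (S := fun k => input_rank k < n.*2.+1)%N) => //.
by rewrite /= ltnn.
Qed.

Let probC2 : prob C2 = (1 - a) * prob C0.
Proof.
rewrite probD//; [|exact: past_measurable mC0|exact: past_measurable mC1].
by rewrite probC1 mulrBl mul1r.
Qed.

Let probJ : prob (C2 `&` S) = jump_matrix Q l j * prob C2.
Proof.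
apply: (@prob_independent _ _ _ P _ _ (fun k => input_rank k < n.*2.+2)%N _
  hindep (hunif (inr (inl n))) _ C2
  [set r | in_slot (fun k => jump_matrix Q l k) j r]) => //.
- by rewrite /= ltnn.
- by apply: measurable_set_of_bool; exact: measurable_in_slot.
- by apply: uniform_slot => [k|]; [exact: jump_matrix_ge0|exact: jump_matrix_row].
Qed.

Let probT : prob (C2 `&` D) = (1 - b) * prob C2.
Proof.
apply: (@prob_independent _ _ _ P _ _ (fun k => input_rank k < n.*2.+3)%N _
  hindep (hunif (inr (inr n.+1))) _ C2 [set r | b <= r]) => //.
- by rewrite /= ltnn.
- by apply: past_sub mC2 => k; exact: ltnW.
- by apply: measurable_set_of_bool; exact: measurable_fun_ler.
- exact: uniform01_ge.
Qed.

Let pathC w : regular w -> B w ->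
  ((u%:E < tau n.+1 w)%E = (W n w < Y w)) /\
  (((u + e)%:E < tau n.+1 w)%E = (W n w < a * Y w)).
Proof.
move=> rw Bw; have [Zn tn] := BZ Bw.
have t0 := regime_time_ge0 iQ (Z^~ w) rw n; rewrite -/(tau n w) in t0.
have tfin : tau n w \is a fin_num by rewrite ge0_fin_numE// (le_lt_trans tn)// ltry.
have tE : regime_time Q (Z^~ w) (fun k => W k w) n = (fine (tau n w))%:E by rewrite fineK.
have tu : fine (tau n w) <= u by rewrite -lee_fin fineK.
rewrite /tau !(lt_regime_timeS iQ rw _ tE) Zn /jump_rate at_label_ord -/q /Y.
rewrite max_r ?subr_ge0//; split => //.
by rewrite /a -expRD; congr (_ < expR _); ring.
Qed.

Let mX t (i : nat) : measurable [set w | X t w = i%:R].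
Proof.
rewrite -[X in measurable X]setTI.
exact: (measurable_path t measurableT (measurable_set1 (i%:R : R))).
Qed.

Let probC : prob C = prob C0.
Proof.
apply: (prob_eq_on measurable_regular regular_full) => //; first exact: past_measurable mC0.
move=> w rw; split => -[Bw h]; split => //; have [E _] := pathC rw Bw.
  by rewrite /= -E.
by rewrite /= E.
Qed.

Let path_step w : regular w -> B w -> W n w < Y w ->
  (W n w < a * Y w -> X (u + e) w = l.+1%:R) /\
  (a * Y w <= W n w -> W n.+1 w < b -> X (u + e) w = (Z n.+1 w)%:R).
Proof.
move=> rw Bw WY; have [E1 E2] := pathC rw Bw; have [Zn tn] := BZ Bw.
have nd := regime_time_nondecreasing iQ (Z^~ w) rw.
split => [W1|W1 Wb].
  rewrite /X (@jump_path_at _ _ _ n)// ?Zn//.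
  apply/andP; split; last by rewrite E2.
  by apply: le_trans tn _; rewrite lee_fin lerDl.
rewrite /X (@jump_path_at _ _ _ n.+1)//; apply/andP; split.
  by rewrite leNgt E2 -leNgt.
apply: (lt_regime_timeS_rate iQ rw e0 (jump_rate_le _)) => //.
by rewrite -/(tau n.+1 w) E1.
Qed.

Let E := C `&` [set w | X (u + e) w = j.+1%:R].

Let mE : measurable E.
Proof. by apply: measurableI => //; exact: mX. Qed.

Let stay := if l == j then C1 else set0.

Let mstay : measurable stay.
Proof. by rewrite /stay; case: ifP => // _; exact: past_measurable mC1. Qed.

Let prob_stay : prob stay = (l == j)%:R * (a * prob C0).
Proof.
by rewrite /stay; case: ifP => _; rewrite ?mul1r ?probC1// mul0r prob0.
Qed.

Let in_S w : B w -> S w <-> Z n.+1 w = j.+1.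
Proof.
move=> Bw; have [Zn _] := BZ Bw.
have slotE : (fun k => at_label (fun i => jump_matrix Q i k) (Z n w)) =
    (fun k => jump_matrix Q l k).
  by apply/funext => k; rewrite Zn at_label_ord.
have -> : Z n.+1 w = select (fun k => jump_matrix Q l k) (V n.+1 w).
  by rewrite -slotE.
have Pi0 k : 0 <= jump_matrix Q l k by exact: jump_matrix_ge0.
split=> [Sw|/eqP]; first exact: select_slot.
by rewrite select_eq.
Qed.

Let upper : prob E <= prob stay + prob (C2 `&` S) + prob (C2 `&` D).
Proof.
have mJ : measurable (C2 `&` S).
  by apply: measurableI; [exact: past_measurable mC2|exact: past_measurable mS].
have mT : measurable (C2 `&` D) by apply: measurableI => //; exact: past_measurable mC2.
have mU : measurable (stay `|` C2 `&` S) by exact: measurableU.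
apply: le_trans (_ : prob (stay `|` C2 `&` S `|` C2 `&` D) <= _); last first.
  by rewrite (le_trans (probU_le _ _ _))// lerD2r probU_le.
apply: (prob_le_on measurable_regular regular_full) => //; first exact: measurableU.
move=> w [[[Bw un] Xj] rw]; have [E1 E2] := pathC rw Bw.
have WY : W n w < Y w by rewrite -E1.
have [stay_l jumped] := path_step rw Bw WY.
have [W1|W1] := ltP (W n w) (a * Y w).
  left; left; have := stay_l W1; rewrite Xj => /eqP.
  rewrite eqr_nat eqSS => /eqP/val_inj jl.
  by rewrite /stay jl eqxx.
have C2w : C2 w by split => // -[_ /=]; rewrite ltNge W1.
have [Wb|Wb] := ltP (W n.+1 w) b; last by right.
left; right; split => //; apply/in_S => //.
by have := jumped W1 Wb; rewrite Xj => /eqP; rewrite eqr_nat => /eqP.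
Qed.

Let lower : prob stay + prob (C2 `&` S) - prob (C2 `&` D) <= prob E.
Proof.
have mJ : measurable (C2 `&` S).
  by apply: measurableI; [exact: past_measurable mC2|exact: past_measurable mS].
have mT : measurable (C2 `&` D) by apply: measurableI => //; exact: past_measurable mC2.
have mU : measurable (stay `|` C2 `&` S) by exact: measurableU.
have stayC w : stay w -> C1 w /\ l = j.
  by rewrite /stay; case: eqP.
rewrite lerBlDr -probU//; last first.
  apply/seteqP; split => w // [/stayC[C1w _] [[_ nC1] _]]; exact: nC1.
apply: le_trans (probU_le _ mE mT).
apply: (prob_le_on measurable_regular regular_full) => //; first exact: measurableU.
move=> w [h rw].
have /= [Bw WY] : C0 w by case: h => [/stayC[/C10]|[[]]].
have [E1 _] := pathC rw Bw.
have Cw : C w by split; rewrite //= E1.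
have [stay_l jumped] := path_step rw Bw WY.
case: h => [/stayC[[_ W1] lj]|[C2w Sw]].
  by left; split; rewrite //= stay_l// lj.
have W1 : a * Y w <= W n w.
  by rewrite leNgt; apply/negP => W1; case: C2w => _; apply.
have [Wb|Wb] := ltP (W n.+1 w) b; last by right.
by left; split; rewrite //= jumped//; move/in_S : Sw => ->.
Qed.

(** The infinitesimal description of the chain. From state l at time u, a jump before
    time u + e has probability 1 - exp (- q e), by memorylessness; V_(n+1) then
    selects a state j other than l with probability Q l j / q; and a second jump
    costs another factor of order e. The event B, from the past of the n-th jump, is carried along. *)
Lemma step_estimate : `|prob (C `&` [set w | X (u + e) w = j.+1%:R]) -
  prob C * ((l == j)%:R + e * Q l j)| <= 2 * (K * e) ^+ 2 * prob C.
Proof.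
rewrite -/E probC.
have := upper; have := lower.
rewrite probT probJ probC2 prob_stay.
set c := prob C0; have c0 : 0 <= c by exact: prob_ge0.
set x := q * e; set y := K * e.
have x0 : 0 <= x by rewrite mulr_ge0.
have xy : x <= y by rewrite ler_wpM2r.
have a_ge : 1 - x <= a by have := expR_ge1Dx (- x); rewrite -/a.
have b_ge : 1 - y <= b by have := expR_ge1Dx (- y); rewrite -/b.
(* From (1 - x + x^2) (1 + x) = 1 + x^3 and 1 + x <= exp x. *)
have a_le : a <= 1 - x + x ^+ 2.
  have x1 : 0 < 1 + x by lra.
  have xexp : 1 <= (1 - x + x ^+ 2) * expR x.
    apply: le_trans (_ : (1 - x + x ^+ 2) * (1 + x) <= _).
      have -> : (1 - x + x ^+ 2) * (1 + x) = 1 + x ^+ 3 by ring.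
      by rewrite lerDl exprn_ge0.
    by rewrite ler_wpM2l ?expR_ge1Dx//; nra.
  by rewrite /a -/x expRN -[leLHS]mul1r ler_pdivrMr// expR_gt0.
have [/andP[a0 a1] /andP[b0 b1]] : 0 <= a <= 1 /\ 0 <= b <= 1 by [].
set Pi := jump_matrix Q l j.
have Pi0 : 0 <= Pi by exact: jump_matrix_ge0.
have Pi1 : Pi <= 1.
  apply: le_trans (jump_matrix_row iQ l).
  by rewrite (bigD1 j)//= lerDl sumr_ge0// => k _; exact: jump_matrix_ge0.
have main : `|(l == j)%:R * a + Pi * (1 - a) - ((l == j)%:R + e * Q l j)| <= x ^+ 2.
  have [lj|lj] := eqVneq l j.
    have Pi00 : Pi = 0 by rewrite /Pi mxE lj eqxx.
    have -> : e * Q l j = - x by rewrite -lj /x /q; ring.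
    rewrite Pi00 /= ler_norml; apply/andP; split; nra.
  have -> : e * Q l j = x * Pi.
    have := rate_jump_matrix iQ l j; rewrite eq_sym (negbTE lj) -/Pi -/q => <-.
    by rewrite /x; ring.
  rewrite /= ler_norml; apply/andP; split; nra.
have two : (1 - b) * (1 - a) <= y ^+ 2.
  rewrite expr2 ler_pM ?subr_ge0//; lra.
rewrite !ler_norml !lerBrDr !lerBlDr => lo up.
move: main; rewrite ler_norml => /andP[m1 m2].
have x2y2 : x ^+ 2 <= y ^+ 2 by rewrite ler_sqr ?nnegrE// (le_trans x0).
apply/andP; split; nra.
Qed.

End Step.

End RegimeLaw.

Definition prev (A : Type) (a0 : A) (a : nat -> A) (k : nat) : A :=
  if k is k'.+1 then a k' else a0.

(** The probability that a Markov jump process with intensity matrix Q, started at i,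
    is in the states x k at the times t k, k < n. *)
Definition path_weight (R : realType) p (Q : 'M[R]_p) (i : 'I_p)
    (t : nat -> R) (x : nat -> 'I_p) (n : nat) : R :=
  \prod_(k < n) expm ((t k - prev 0 t k) *: Q) (prev i x k) (x k).

Lemma visitsS (R : realType) p (T : Type) (Y : R -> T -> R) (t : nat -> R)
    (x : nat -> 'I_p) n :
  visits Y t x n.+1 = visits Y t x n `&` [set w | Y (t n) w = label R (x n)].
Proof.
apply/seteqP; split => w /=.
  by move=> h; split => [k kn|]; apply: h => //; exact: ltnW.
by move=> [h hn] k; rewrite ltnS leq_eqVlt => /predU1P[->//|]; exact: h.
Qed.

Lemma measurable_visits (R : realType) p d (T : measurableType d) (X : R -> T -> R)
    (t : nat -> R) (x : nat -> 'I_p) n :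
  (forall k, measurable_fun setT (X (t k))) -> measurable (visits X t x n).
Proof.
move=> mX; elim: n => [|n IH].
  by rewrite (_ : visits _ _ _ _ = setT)//; apply/seteqP; split.
rewrite visitsS; apply: measurableI => //.
rewrite -[X in measurable X]setTI.
exact: (mX n measurableT _ (measurable_set1 (label R (x n)))).
Qed.

Section RegimeTransition.
Context (R : realType) (p : nat) (Q : 'M[R]_p) (i0 : 'I_p).
Context d (T : measurableType d) (P : probability T R).
Variables (U0 U : {RV P >-> R}) (V W : nat -> {RV P >-> R}).
Hypothesis iQ : is_intensity Q.
Hypothesis hunif : forall k, is_uniform01 (inputs U0 U V W k).
Hypothesis hindep : mutually_independent (inputs U0 U V W).

Notation history m := (past (inputs U0 U V W) (fun k => input_rank k < m)%N).
Notation prob := (prob P).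
Notation Z := (regime_state Q i0 V).
Notation tau := (regime_jump Q i0 V W).
Notation X := (regime_path Q i0 V W).
Notation regular := (regular W).

Let mreg := measurable_regular W.
Let reg1 := regular_full hunif.

Let nd_tau w : regular w -> nondecreasing_seq (tau^~ w).
Proof. by move=> rw; exact: (regime_time_nondecreasing iQ (Z^~ w) rw). Qed.

Let mX t (i : nat) : measurable [set w | X t w = i%:R].
Proof.
rewrite -[X in measurable X]setTI.
exact: (measurable_path Q i0 U0 U V W t measurableT (measurable_set1 (i%:R : R))).
Qed.

Lemma path_stateP w v (l : 'I_p) : regular w -> X v w = l.+1%:R <->
  exists n, (tau n w <= v%:E < tau n.+1 w)%E /\ Z n w = l.+1.
Proof.
move=> rw; split=> [Xl|[n [nv Zl]]]; last first.
  by rewrite /regime_path (@jump_path_at _ _ _ n)// ?Zl//; exact: nd_tau.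
have [[n nv]|nv] := pselect (exists n, (tau n w <= v%:E < tau n.+1 w)%E).
  exists n; split => //; move: Xl; rewrite /regime_path (@jump_path_at _ _ _ n)//.
    by move=> /eqP; rewrite eqr_nat => /eqP.
  exact: nd_tau.
move: Xl; rewrite /regime_path jump_path_out => [/esym/eqP|n].
  by rewrite pnatr_eq0.
by apply/negP => h; apply: nv; exists n.
Qed.

(** A path that has exploded by time v, or left the states, never comes back. *)
Lemma path_state_before w v e (j : 'I_p) : regular w -> 0 <= v -> 0 <= e ->
  X (v + e) w = j.+1%:R -> exists l : 'I_p, X v w = l.+1%:R.
Proof.
move=> rw v0 e0 Xj.
have [m [/andP[mv vm] Zm]] := (path_stateP _ _ rw).1 Xj.
have hm : exists k, (v%:E < tau k w)%E.
  by exists m.+1; apply: le_lt_trans vm; rewrite lee_fin lerDl.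
case: (ex_minnP hm) => -[|n] vn min; first by move: vn; rewrite ltNge lee_fin v0.
have nv : (tau n w <= v%:E)%E.
  by rewrite leNgt; apply/negP => /min; rewrite ltnn.
have [[l Zl]|Zn] := labelP p (Z n w).
  by exists l; apply/path_stateP => //; exists n; rewrite nv vn.
(* Otherwise the label after the n-th jump is not a state; its rate is 0, so that
   the path keeps this label up to time v + e. *)
have tfin : tau n w \is a fin_num.
  rewrite ge0_fin_numE ?(le_lt_trans nv) ?ltry//.
  exact: (regime_time_ge0 iQ (Z^~ w) rw).
have tE : regime_time Q (Z^~ w) (fun k => W k w) n = (fine (tau n w))%:E by rewrite fineK.
have ven : ((v + e)%:E < tau n.+1 w)%E.
  rewrite [tau _ _](_ : _ = regime_time Q (Z^~ w) (fun k => W k w) n.+1)//.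
  rewrite (lt_regime_timeS iQ rw _ tE) /jump_rate at_label_eq0//.
  by rewrite mul0r oppr0 expR0; have /andP[] := rw n.
move: Xj; rewrite /regime_path (@jump_path_at _ _ _ n)//; last 2 first.
- exact: nd_tau.
- by rewrite ven andbT (le_trans nv)// lee_fin lerDl.
by move=> /eqP; rewrite eqr_nat => /eqP Zj; have := Zn j; rewrite Zj eqxx.
Qed.

(** The past up to time u, without stopping times: seen from any later time v,
    such an event is a function of the inputs read before the last jump by v. *)
Definition past_event (u : R) (A : set T) : Prop :=
  measurable A /\ forall v n, u <= v -> exists B : set T,
    measurable (B : set (history n.*2.+1)) /\
    forall w, regular w -> (tau n w <= v%:E < tau n.+1 w)%E -> A w <-> B w.

Let K : R := \sum_i - Q i i.

Let K0 : 0 <= K.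
Proof. by rewrite sumr_ge0// => i _; rewrite oppr_ge0; exact: intensity_diag. Qed.

Let mtau n : measurable_fun setT (tau n).
Proof.
exact: (@past_measurable_fun _ _ _ P _ (inputs U0 U V W) _ _ _ _
  (measurable_jump Q i0 (leqnn n.*2))).
Qed.

(** The step estimate, summed over the number n of jumps before time v. *)
Lemma conditional_step (u v e : R) A (l j : 'I_p) : past_event u A ->
  0 <= v -> u <= v -> 0 <= e ->
  `|prob (A `&` [set w | X v w = l.+1%:R] `&` [set w | X (v + e) w = j.+1%:R]) -
    prob (A `&` [set w | X v w = l.+1%:R]) * ((l == j)%:R + e * Q l j)| <=
  2 * (K * e) ^+ 2 * prob (A `&` [set w | X v w = l.+1%:R]).
Proof.
move=> [mA pA] v0 uv e0.
set c := (l == j)%:R + e * Q l j; set eps := 2 * (K * e) ^+ 2.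
have /choice[B /all_and2[mB BA]] := fun n => pA v n uv.
pose C n := B n `&` [set w | Z n w = l.+1 /\ (tau n w <= v%:E)%E].
have mC n : measurable (C n : set (history n.*2.+1)).
  apply: measurableI => //; rewrite (_ : [set w | _] =
    [set w | (Z n w == l.+1) && (tau n w <= v%:E)%E]).
    apply: measurable_set_of_bool; apply: measurable_and.
      apply: (measurable_of_nat (fun k => k == l.+1)).
      exact: measurable_state (ltnSn _).
    apply: measurable_fun_lee => //.
    exact: measurable_jump (leqnSn _).
  by apply/seteqP; split => w /=; [move=> [/eqP-> ->]|move=> /andP[/eqP -> ->]].
pose Cu n := C n `&` [set w | (v%:E < tau n.+1 w)%E].
pose H := [set w | X (v + e) w = j.+1%:R].
have mH : measurable H by exact: mX.
have mCu n : measurable (Cu n).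
  apply: measurableI; first exact: past_measurable (mC n).
  by apply: measurable_set_of_bool; exact: measurable_fun_lte.
have est n : `|prob (Cu n `&` H) - prob (Cu n) * c| <= eps * prob (Cu n).
  by apply: (step_estimate iQ hunif hindep _ e0 (mC n)) => w [_ []].
(* The events Cu n are disjoint only where the jump times increase. *)
pose Cr n := Cu n `&` regular.
have mCr n : measurable (Cr n) by exact: measurableI.
have CrE n : prob (Cr n) = prob (Cu n) by rewrite prob_setI.
have CrHE n : prob (Cr n `&` H) = prob (Cu n `&` H).
  apply: (prob_eq_on mreg reg1); [exact: measurableI|exact: measurableI|].
  by move=> w rw; split => [[[? _] ?]|[? ?]].
have tCr : trivIset setT Cr.
  apply/trivIsetP => n m _ _ nm; apply/seteqP.
  split => w // -[[[[_ [_ n1]] n2] rw] [[[_ [_ m1]] m2] _]].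
  have nd := nd_tau rw.
  case: (ltngtP n m) nm => // nm _.
    by have := lt_le_trans n2 (le_trans (nd _ _ nm) m1); rewrite ltxx.
  by have := lt_le_trans m2 (le_trans (nd _ _ nm) n1); rewrite ltxx.
pose F := A `&` [set w | X v w = l.+1%:R].
have mF : measurable F by apply: measurableI => //; exact: mX.
have UCr w : regular w -> (\bigcup_n Cr n) w <-> F w.
  move=> rw; split=> [[n _ [[[Bn [Zn n1]] n2] _]]|[Aw /path_stateP-/(_ rw)[n [/andP[n1 n2] Zn]]]].
    have nv : (tau n w <= v%:E < tau n.+1 w)%E by apply/andP.
    split; first exact/(BA n w rw nv).
    by apply/path_stateP => //; exists n.
  have nv : (tau n w <= v%:E < tau n.+1 w)%E by apply/andP.
  by exists n => //; split=> //; split => //; split => //; apply/(BA n w rw nv).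
have mUCr : measurable (\bigcup_n Cr n) by exact: bigcup_measurable.
have FE : prob F = prob (\bigcup_n Cr n).
  by apply: (prob_eq_on mreg reg1) => // w rw; apply: iff_sym; exact: UCr.
have FHE : prob (F `&` H) = prob (\bigcup_n Cr n `&` H).
  apply: (prob_eq_on mreg reg1); [exact: measurableI|exact: measurableI|].
  by move=> w rw; split => -[Fw Hw]; split => //; apply/(UCr w rw).
have up : prob (\bigcup_n Cr n `&` H) <= (c + eps) * prob (\bigcup_n Cr n).
  apply: prob_bigcup_le => // n; rewrite CrE CrHE.
  by have := est n; rewrite ler_norml => /andP[_]; lra.
have lo : (c - eps) * prob (\bigcup_n Cr n) <= prob (\bigcup_n Cr n `&` H).
  apply: prob_bigcup_ge => // n; rewrite CrE CrHE.
  by have := est n; rewrite ler_norml => /andP[]; lra.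
by rewrite -/F -/H FE FHE ler_norml; apply/andP; split; lra.
Qed.

Lemma forward_step (u v e : R) A (j : 'I_p) : past_event u A ->
  0 <= v -> u <= v -> 0 <= e ->
  `|prob (A `&` [set w | X (v + e) w = j.+1%:R]) -
    \sum_(l < p) prob (A `&` [set w | X v w = l.+1%:R]) * ((l == j)%:R + e * Q l j)| <=
  p%:R * (2 * K ^+ 2) * e ^+ 2.
Proof.
move=> pA v0 uv e0; have [mA _] := pA.
pose H := [set w | X (v + e) w = j.+1%:R].
have mH : measurable H by exact: mX.
have mAX l : measurable (A `&` [set w | X v w = l.+1%:R]).
  by apply: measurableI => //; exact: mX.
have -> : prob (A `&` H) = \sum_(l < p) prob (A `&` [set w | X v w = l.+1%:R] `&` H).
  rewrite -(prob_setI mreg reg1); last exact: measurableI.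
  rewrite (prob_split P (E := fun l : 'I_p => [set w | X v w = l.+1%:R])).
  - apply: eq_bigr => l _; apply: (prob_eq_on mreg reg1).
    + by apply: measurableI; [apply: measurableI => //; exact: measurableI|exact: mX].
    + exact: measurableI.
    + by move=> w rw; split => [[[[? ?] ?] ?]|[[? ?] ?]].
  - by apply: measurableI => //; exact: measurableI.
  - by move=> l; exact: mX.
  - move=> l k w /= -> /eqP; rewrite eqr_nat eqSS => /eqP; exact: val_inj.
  - by move=> w [[_ Hw] rw]; exact: path_state_before rw v0 e0 Hw.
rewrite -sumrB (le_trans (ler_norm_sum _ _ _))//.
rewrite (_ : _ * e ^+ 2 = \sum_(l < p) 2 * (K * e) ^+ 2); last first.
  by rewrite sumr_const card_ord -[RHS]mulr_natl; ring.
apply: ler_sum => l _; apply: le_trans (conditional_step _ _ pA v0 uv e0) _.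
by rewrite ler_piMr ?prob_le1// mulr_ge0// exprn_ge0// mulr_ge0.
Qed.

(** The Markov property. Given the past up to time u, the law of the state at time
    u + t solves the forward equation up to errors of second order, as does the
    exponential; the discrete uniqueness lemma identifies them. *)
Lemma transition_law (u t : R) A (x j : 'I_p) : past_event u A -> 0 <= u -> 0 <= t ->
  (forall w, regular w -> A w -> X u w = x.+1%:R) ->
  prob (A `&` [set w | X (u + t) w = j.+1%:R]) = prob A * expm (t *: Q) x j.
Proof.
move=> pA u0 t0 Ax; have [mA _] := pA.
pose h s (k : 'I_p) :=
  prob (A `&` [set w | X (u + s) w = k.+1%:R]) - prob A * expm (s *: Q) x k.
have [Ce Ce0 hCe] := expm_step Q t.
suff : h t j = 0 by move=> /eqP; rewrite subr_eq0 => /eqP.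
apply: (discrete_gronwall (C := p%:R * (2 * K ^+ 2) + prob A * Ce) iQ t0 (ltr01)).
  move=> k; rewrite /h addr0 expm0.
  have [<-|xk] := eqVneq x k.
    rewrite mulr1; apply/eqP; rewrite subr_eq0; apply/eqP.
    apply: (prob_eq_on mreg reg1) => //.
      by apply: measurableI => //; exact: mX.
    by move=> w rw; split => [[]//|Aw]; split => //; exact: Ax.
  rewrite mulr0 subr0 -[RHS](_ : prob set0 = 0); last exact: prob0.
  apply: (prob_eq_on mreg reg1) => //.
    by apply: measurableI => //; exact: mX.
  move=> w rw; split => // -[Aw /=]; rewrite (Ax w rw Aw) => /eqP.
  by rewrite eqr_nat eqSS => /eqP/val_inj/eqP; rewrite (negbTE xk).
move=> v e k v0 e0 e1 vet.
have us : u <= u + v by rewrite lerDl.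
have hp := forward_step k pA (addr_ge0 u0 v0) us e0.
have hE := hCe x k v e v0 e0 vet.
have -> : \sum_l h v l * ((l == k)%:R + e * Q l k) =
    \sum_(l < p) prob (A `&` [set w | X (u + v) w = l.+1%:R]) *
      ((l == k)%:R + e * Q l k) -
    prob A * \sum_l expm (v *: Q) x l * ((l == k)%:R + e * Q l k).
  rewrite mulr_sumr -sumrB; apply: eq_bigr => l _.
  by rewrite /h mulrBl mulrA.
rewrite /h addrA.
set s1 := \sum_(l < p) _ in hp *; set s2 := \sum_l _ in hE *.
set E := expm _ _ _ in hE *; set p1 := prob (A `&` _) in hp *.
have -> : p1 - prob A * E - (s1 - prob A * s2) = (p1 - s1) - prob A * (E - s2) by ring.
rewrite (le_trans (ler_normB _ _))// mulrDl lerD// normrM -mulrA.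
by rewrite ger0_norm ?prob_ge0// ler_wpM2l// prob_ge0.
Qed.

Lemma visits_past_event D (t : nat -> R) (x : nat -> 'I_p) n u :
  measurable (D : set (history 1)) ->
  (forall k, (k < n)%N -> t k <= u) -> past_event u (D `&` visits X t x n).
Proof.
move=> mD tu; split.
  apply: measurableI; first exact: past_measurable mD.
  by apply: measurable_visits => k; exact: measurable_path.
move=> v m uv.
pose B := [set w | forall k, (k < n)%N ->
  truncated_path (Z^~ w) (tau^~ w) m (t k) = label R (x k)].
exists (D `&` B); split.
  apply: measurableI.
    by apply: past_sub mD => k k1; apply: (leq_trans k1).
  rewrite (_ : B = \bigcap_(k in [set k | (k < n)%N])
    [set w | truncated_path (Z^~ w) (tau^~ w) m (t k) == label R (x k)]); last first.
    by apply/seteqP; split => w /= h k kn; apply/eqP; exact: h.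
  apply: bigcap_measurableType => k _; apply: measurable_set_of_bool.
  apply: measurable_fun_eqr => //.
  apply: measurable_funD.
    apply: measurable_sum => l; apply: measurable_funM.
      apply: (measurable_of_nat (fun k => k%:R : R)); apply: measurable_state.
      by rewrite ltnS leq_double ltnW.
    apply: (measurable_of_bool (fun b : bool => b%:R : R)).
    apply: measurable_and.
      apply: measurable_fun_lee => //; apply: measurable_jump.
      by rewrite (leq_trans _ (leqnSn _))// leq_double ltnW.
    apply: measurable_fun_lte => //; apply: measurable_jump.
    by rewrite (leq_trans _ (leqnSn _))// leq_double.
  apply: measurable_funM.
    by apply: (measurable_of_nat (fun k => k%:R : R)); exact: measurable_state.
  apply: (measurable_of_bool (fun b : bool => b%:R : R)).
  by apply: measurable_fun_lee => //; apply: measurable_jump; exact: leqnSn.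
move=> w rw /andP[_ mv].
have trE k : (k < n)%N -> X (t k) w = truncated_path (Z^~ w) (tau^~ w) m (t k).
  move=> kn; apply: (@jump_path_truncated _ _ _ m (t k) v) => //; first exact: nd_tau.
  exact: le_trans (tu k kn) uv.
split => -[Dw h]; split => // k kn; first by rewrite -trE//; exact: h.
by rewrite trE//; exact: h.
Qed.

Lemma path_start w : regular w -> X 0 w = i0.+1%:R.
Proof.
move=> rw; apply/path_stateP => //; exists 0%N; split => //.
have /andP[w0 w1] := rw 0%N.
have tE : regime_time Q (Z^~ w) (fun k => W k w) 0 = 0%:E by [].
rewrite lexx/= [tau _ _](_ : _ = regime_time Q (Z^~ w) (fun k => W k w) 1)//.
by rewrite (lt_regime_timeS iQ rw _ tE) subrr mulr0 oppr0 expR0.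
Qed.

(** D is an event on the inputs of rank 0, those that choose the initial state and
    the regime; the path within a given regime is independent of it. *)
Lemma regime_fdd D (t : nat -> R) (x : nat -> 'I_p) n :
  measurable (D : set (history 1)) ->
  0 <= t 0%N -> nondecreasing_seq t ->
  prob (D `&` visits X t x n) = prob D * path_weight Q i0 t x n.
Proof.
move=> mD t0 nd; elim: n => [|n IH].
  rewrite /path_weight big_ord0 mulr1 (_ : visits _ _ _ _ = setT) ?setIT//.
  by apply/seteqP; split.
have tge0 k : 0 <= t k by rewrite (le_trans t0)// nd.
have prev0 : 0 <= prev 0 t n by case: n {IH} => //= k.
have prevt : prev 0 t n <= t n by case: n {IH prev0} => //= k; exact: nd.
rewrite /path_weight big_ord_recr/= -/(path_weight Q i0 t x n) mulrA -IH.
rewrite visitsS setIA.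
rewrite -(@transition_law (prev 0 t n)) ?subr_ge0//.
- by rewrite addrC subrK.
- apply: visits_past_event => // k; case: n {IH prev0 prevt} => //= n; rewrite ltnS.
  exact: nd.
- move=> w rw [_]; case: n {IH prev0 prevt} => [_|n /=]; first exact: path_start.
  by apply.
Qed.

End RegimeTransition.

(** * Laws of processes with finitely many states *)

Section FiniteEvents.
Context d (T : measurableType d) (R : realType) (P : probability T R).
Notation prob := (prob P).

Lemma prob_full G : measurable G -> prob G = 1 -> P (~` G) = 0%E.
Proof. by move=> mG G1; rewrite probability_setC// probE// G1 subee. Qed.

Lemma prob_by_events (I : finType) (E : I -> set T) (b : pred I) (G A : set T) :
  measurable G -> P (~` G) = 0%E -> measurable A ->
  (forall i, measurable (E i)) ->
  (forall i k w, E i w -> E k w -> i = k) ->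
  (forall w, G w -> exists i, E i w) ->
  (forall i w, E i w -> A w <-> b i) ->
  prob A = \sum_(i | b i) prob (E i).
Proof.
move=> mG G1 mA mE dE cE bA.
rewrite -(prob_setI mG G1)// (prob_split P (E := E))//; last 2 first.
- exact: measurableI.
- by move=> w [_]; exact: cE.
rewrite [RHS]big_mkcond/=; apply: eq_bigr => i _; case: ifPn => bi.
  apply: (prob_eq_on mG G1) => //.
    by apply: measurableI => //; exact: measurableI.
  by move=> w Gw; split => [[]//|Ei]; split => //; split => //; exact/(bA _ _ Ei).
rewrite (_ : _ `&` _ = set0) ?prob0//; apply/seteqP; split => w // [[Aw _] Ei].
by move/negP: bi; apply; exact/(bA _ _ Ei).
Qed.

Lemma cond_probE A B : measurable A -> measurable B -> P B != 0%E ->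
  cond_prob P A B = (prob (A `&` B) / prob B)%:E.
Proof.
move=> mA mB B0; rewrite /cond_prob !probE//; last exact: measurableI.
by move: B0; rewrite probE// eqe => B0; rewrite inver (negbTE B0).
Qed.

End FiniteEvents.

Lemma label_inj (R : realType) p : injective (@label R p).
Proof. by move=> i j /eqP; rewrite eqr_nat eqSS => /eqP/val_inj. Qed.

(** Sampled states indexed by a finite type, in the form that [visits] takes; the
    value i beyond n is arbitrary. *)
Definition extend p n (i : 'I_p) (x : {ffun 'I_n -> 'I_p}) (k : nat) : 'I_p :=
  if insub k is Some k' then x k' else i.

Lemma extend_ord p n (i : 'I_p) (x : {ffun 'I_n -> 'I_p}) (k : 'I_n) :
  extend i x k = x k.
Proof. by rewrite /extend valK. Qed.

Section Visits.
Context (R : realType) (p : nat) (T : Type) (X : R -> T -> R).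

Lemma visits_extend (t : nat -> R) i n (x : {ffun 'I_n -> 'I_p}) w :
  visits X t (extend i x) n w <-> forall k : 'I_n, X (t k) w = label R (x k).
Proof.
split=> [h k|h k kn]; first by rewrite h ?extend_ord.
by rewrite (h (Ordinal kn)) -(extend_ord i).
Qed.

Lemma visits_extend_inj (t : nat -> R) i n (x y : {ffun 'I_n -> 'I_p}) w :
  visits X t (extend i x) n w -> visits X t (extend i y) n w -> x = y.
Proof.
move=> /visits_extend hx /visits_extend hy; apply/ffunP => k.
by apply: (@label_inj R); rewrite -hx.
Qed.

Lemma visits_cover (t : nat -> R) i n w :
  (forall k, (k < n)%N -> exists j : 'I_p, X (t k) w = label R j) ->
  exists x : {ffun 'I_n -> 'I_p}, visits X t (extend i x) n w.
Proof.
move=> h; have /choice[x hx] : forall k : 'I_n, exists j : 'I_p, X (t k) w = label R j.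
  by move=> k; exact: h.
by exists (finfun x); apply/visits_extend => k; rewrite ffunE.
Qed.

End Visits.

Section SampledLaw.
Context (R : realType) (p M : nat) (Q : 'I_M -> 'M[R]_p).
Variables (ini : 'rV[R]_p) (s : 'I_M -> 'rV[R]_p).

(** The right-hand side depends on Q, ini and s only: this is how the laws of two
    processes on different probability spaces are compared. *)
Lemma prob_samples d (T : measurableType d) (P : probability T R)
    (X : R -> T -> R) (D : 'I_p -> 'I_M -> set T) (t : nat -> R) (n : nat)
    (G : set T) (B : nat -> set R) :
  (forall k, measurable_fun setT (X (t k))) ->
  (forall i m, measurable (D i m)) ->
  (forall i m i' m' w, D i m w -> D i' m' w -> i = i' /\ m = m') ->
  measurable G -> P (~` G) = 0%E ->
  (forall w, G w -> exists i m, D i m w /\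
     forall k, (k < n)%N -> exists j : 'I_p, X (t k) w = label R j) ->
  (forall i m (x : {ffun 'I_n -> 'I_p}), prob P (D i m `&` visits X t (extend i x) n) =
     ini ord0 i * s m ord0 i * path_weight (Q m) i t (extend i x) n) ->
  (forall k, measurable (B k)) ->
  P [set w | forall k, (k < n)%N -> B k (X (t k) w)] =
  (\sum_(c : 'I_p * 'I_M * {ffun 'I_n -> 'I_p} |
      [forall k : 'I_n, label R (c.2 k) \in B k])
    ini ord0 c.1.1 * s c.1.2 ord0 c.1.1 *
      path_weight (Q c.1.2) c.1.1 t (extend c.1.1 c.2) n)%:E.
Proof.
move=> mX mD dD mG G1 cG wD mB.
have mA : measurable [set w | forall k, (k < n)%N -> B k (X (t k) w)].
  rewrite (_ : [set w | _] = \bigcap_(k in [set k | (k < n)%N]) (X (t k) @^-1` B k)).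
    apply: bigcap_measurableType => k _.
    by rewrite -[Y in measurable Y]setTI; exact: mX.
  by apply/seteqP; split.
rewrite probE//; congr EFin.
pose E (c : 'I_p * 'I_M * {ffun 'I_n -> 'I_p}) :=
  D c.1.1 c.1.2 `&` visits X t (extend c.1.1 c.2) n.
rewrite (prob_by_events (E := E) (b := fun c : 'I_p * 'I_M * {ffun 'I_n -> 'I_p} =>
  [forall k : 'I_n, label R (c.2 k) \in B k]) mG G1)//.
- by apply: eq_bigr => c _; exact: wD.
- by move=> c; apply: measurableI => //; exact: measurable_visits.
- move=> [[i m] x] [[i' m'] x'] w [/= Dw Xw] [/= Dw' Xw'].
  have [ii mm] := dD _ _ _ _ _ Dw Dw'; move: Xw'; rewrite -ii -mm => Xw'.
  by rewrite (visits_extend_inj Xw Xw').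
- move=> w Gw; have [i [m [Dw h]]] := cG w Gw.
  have [x xw] := visits_cover i h.
  by exists (i, m, x).
- move=> [[i m] x] w [/= _ /visits_extend h]; split.
    by move=> hB; apply/forallP => k; rewrite inE -h; exact: hB.
  move=> /forallP hB k kn; have := hB (Ordinal kn).
  by rewrite inE -h.
Qed.

End SampledLaw.

Section FullRegimes.
Context (R : realType) (p M : nat).
Variables (ini : 'rV[R]_p) (s : 'I_M -> 'rV[R]_p).
Hypothesis hini : is_distribution ini.
Hypothesis hs : is_switching s.

Lemma sum_regimes : \sum_(c : 'I_p * 'I_M) ini ord0 c.1 * s c.2 ord0 c.1 = 1.
Proof.
rewrite -(pair_bigA _ (fun i m => ini ord0 i * s m ord0 i))/=.
rewrite -[RHS](hini.2); apply: eq_bigr => i _.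
by rewrite -mulr_sumr hs.2 mulr1.
Qed.

Lemma regimes_full d (T : measurableType d) (P : probability T R)
    (D : 'I_p -> 'I_M -> set T) :
  (forall i m, measurable (D i m)) ->
  (forall i m i' m' w, D i m w -> D i' m' w -> i = i' /\ m = m') ->
  (forall i m, prob P (D i m) = ini ord0 i * s m ord0 i) ->
  measurable [set w | exists i m, D i m w] /\
  P (~` [set w | exists i m, D i m w]) = 0%E.
Proof.
move=> mD dD pD.
have mG : measurable [set w | exists i m, D i m w].
  rewrite (_ : [set w | _] = \big[setU/set0]_(c : 'I_p * 'I_M) D c.1 c.2).
    by apply: bigsetU_measurable => c _.
  rewrite -bigcup_seq; apply/seteqP; split => w /=.
    by move=> [i [m Dw]]; exists (i, m); rewrite //= mem_index_enum.
  by move=> [[i m] _ Dw]; exists i, m.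
split => //; apply: prob_full => //.
rewrite (prob_split P (E := fun c : 'I_p * 'I_M => D c.1 c.2))//.
- rewrite -sum_regimes; apply: eq_bigr => -[i m] _ /=; rewrite -pD; congr prob.
  by apply/seteqP; split => w; [move=> []|move=> Dw; split => //; exists i, m].
- move=> [i m] [i' m'] w /= Dw Dw'.
  by have [-> ->] := dD _ _ _ _ _ Dw Dw'.
- by move=> w [i [m Dw]]; exists (i, m).
Qed.

End FullRegimes.

(** * Mixtures of Markov jump processes *)

Section MixtureLaw.
Context (R : realType) (p M : nat) (Q : 'I_M -> 'M[R]_p).
Variables (ini : 'rV[R]_p) (s : 'I_M -> 'rV[R]_p).
Context d (T : measurableType d) (P : probability T R).
Variables (phi : T -> nat) (Xm : 'I_M -> R -> T -> R) (X0 : T -> R) (Y : R -> T -> R).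
Hypothesis hini : is_distribution ini.
Hypothesis hs : is_switching s.
Hypothesis mix : is_mixture_of_mjp P Q ini s phi Xm X0 Y.
Notation prob := (prob P).

Lemma mjp_path_law (m : 'I_M) (t : nat -> R) (x : nat -> 'I_p) n :
  0 <= t 0%N -> nondecreasing_seq t ->
  prob (visits (Xm m) t x n.+1) = prob (visits (Xm m) t x 1) *
    \prod_(k < n) expm ((t k.+1 - t k) *: Q m) (x k) (x k.+1).
Proof.
move=> t0 nd; have X_mjp := mix_mjp mix m.
have tge0 k : 0 <= t k by rewrite (le_trans t0)// nd.
have mX k : measurable_fun setT (Xm m (t k)) by exact: (mjp_measurable X_mjp).
have mV k : measurable (visits (Xm m) t x k) by exact: measurable_visits.
elim: n => [|n IH]; first by rewrite big_ord0 mulr1.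
rewrite big_ord_recr/= mulrA -IH.
have [V0|V0] := eqVneq (P (visits (Xm m) t x n.+1)) 0%E.
  have pV0 : prob (visits (Xm m) t x n.+1) = 0 by rewrite /prob V0.
  rewrite pV0 mul0r; apply/eqP; rewrite eq_le prob_ge0 andbT -pV0.
  by apply: prob_le => // w; rewrite visitsS => -[].
have := mjp_markov X_mjp t0 nd V0.
have mXn : measurable [set w | Xm m (t n.+1) w = label R (x n.+1)].
  rewrite -[X in measurable X]setTI.
  exact: (mX n.+1 measurableT _ (measurable_set1 (label R (x n.+1)))).
rewrite cond_probE// => -[] <-.
rewrite setIC -visitsS mulrC divfK//.
by move: V0; rewrite probE// eqe.
Qed.

Let D (i : 'I_p) (m : 'I_M) := [set w | X0 w = label R i] `&` [set w | phi w = m.+1].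

Let mX0 (M_gt0 : 'I_M) (i : 'I_p) : measurable [set w | X0 w = label R i].
Proof.
have -> : X0 = Xm M_gt0 0 by apply/funext => w; rewrite (mix_start mix).
rewrite -[X in measurable X]setTI.
exact: (mjp_measurable (mix_mjp mix M_gt0) (lexx 0) measurableT
  (measurable_set1 (label R i))).
Qed.

Let mphi (m : 'I_M) : measurable [set w | phi w = m.+1].
Proof.
rewrite -[X in measurable X]setTI.
exact: (mix_regime_measurable mix measurableT (I : measurable [set m.+1])).
Qed.

Let mD i m : measurable (D i m).
Proof. by apply: measurableI; [exact: mX0|exact: mphi]. Qed.

Lemma prob_mix_initial (i : 'I_p) : prob [set w | X0 w = label R i] = ini ord0 i.
Proof. by rewrite /prob (mix_initial mix). Qed.

Lemma prob_mix_regime i m : prob (D i m) = ini ord0 i * s m ord0 i.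
Proof.
have mi := mX0 m i.
have [i0|i0] := eqVneq (P [set w | X0 w = label R i]) 0%E.
  have pi0 : prob [set w | X0 w = label R i] = 0 by rewrite /prob i0.
  rewrite -prob_mix_initial pi0 mul0r; apply/eqP; rewrite eq_le prob_ge0 andbT -pi0.
  by apply: prob_le => // w [].
have := mix_regime mix m i0; rewrite cond_probE// => -[] <-.
rewrite -prob_mix_initial mulrC divfK; first by rewrite setIC.
by move: i0; rewrite probE// eqe.
Qed.

(** The initial state is put in as a sample at time 0. *)
Lemma mjp_path_law_from (m : 'I_M) (i : 'I_p) (t : nat -> R) (y : nat -> 'I_p) n :
  0 <= t 0%N -> nondecreasing_seq t ->
  prob ([set w | X0 w = label R i] `&` visits (Xm m) t y n) =
  ini ord0 i * path_weight (Q m) i t y n.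
Proof.
move=> t0 nd.
have nd' : nondecreasing_seq (prev 0 t).
  by apply/nondecreasing_seqP => -[|k] //=; exact: nd.
have := mjp_path_law m (prev i y) n (lexx (prev 0 t 0%N)) nd'.
have -> : visits (Xm m) (prev 0 t) (prev i y) n.+1 =
    [set w | X0 w = label R i] `&` visits (Xm m) t y n.
  apply/seteqP; split => w /=.
    move=> h; split; first by rewrite -(h 0%N) //= (mix_start mix).
    by move=> k kn; exact: (h k.+1).
  by move=> [Xi h] [_|k kn]; [rewrite /= (mix_start mix)|exact: h].
have -> : visits (Xm m) (prev 0 t) (prev i y) 1 = [set w | X0 w = label R i].
  apply/seteqP; split => w /=; first by move=> /(_ 0%N isT) /=; rewrite (mix_start mix).
  by move=> Xi [|//] _; rewrite /= (mix_start mix).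
by move=> ->; rewrite prob_mix_initial.
Qed.

(** The independence given the initial state bears on the paths of all regimes
    jointly; summing over the paths of the regimes other than m leaves the
    weight of the path of regime m. *)
Lemma mixture_path_weight i m (t : nat -> R) n (y : {ffun 'I_n -> 'I_p}) :
  0 <= t 0%N -> nondecreasing_seq t ->
  prob (D i m `&` visits Y t (extend i y) n) =
  ini ord0 i * s m ord0 i * path_weight (Q m) i t (extend i y) n.
Proof.
move=> t0 nd; have tge0 k : 0 <= t k by rewrite (le_trans t0)// nd.
have mXk k (l : nat) : measurable_fun setT (Xm k (t l)).
  exact: (mjp_measurable (mix_mjp mix k)).
have mi := mX0 m i.
have -> : D i m `&` visits Y t (extend i y) n =
    D i m `&` visits (Xm m) t (extend i y) n.
  have YX w k : phi w = m.+1 -> Y (t k) w = Xm m (t k) w.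
    move=> wm; rewrite (mix_repr mix)// wm (bigD1 m)//= eqxx mul1r big1 ?addr0// => l lm.
    by rewrite eqSS -[_ == _ :> nat]/(m == l) eq_sym (negbTE lm) mul0r.
  apply/seteqP; split => w [[wi wm] h]; split => // k kn.
    by rewrite -YX//; exact: h.
  by rewrite YX//; exact: h.
have [i0|i0] := eqVneq (P [set w | X0 w = label R i]) 0%E.
  have pi0 : prob [set w | X0 w = label R i] = 0 by rewrite /prob i0.
  rewrite -prob_mix_initial pi0 !mul0r; apply/eqP; rewrite eq_le prob_ge0 andbT -pi0.
  apply: prob_le => //; last by move=> w [[]].
  by apply: measurableI => //; exact: measurable_visits.
have pi0 : prob [set w | X0 w = label R i] != 0 by move: i0; rewrite probE// eqe.
pose c k (z : {ffun 'I_n -> 'I_p}) : R :=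
  prob (visits (Xm k) t (extend i z) n `&` [set w | X0 w = label R i]) /
  prob [set w | X0 w = label R i].
have sum_c k : \sum_z c k z = 1.
  rewrite -mulr_suml -[RHS](divff pi0); congr (_ / _).
  rewrite [RHS](prob_split P
    (E := fun z : {ffun 'I_n -> 'I_p} => visits (Xm k) t (extend i z) n))//.
  - by apply: eq_bigr => z _; rewrite setIC.
  - by move=> z; exact: measurable_visits.
  - by move=> x z w; exact: visits_extend_inj.
  - move=> w _; apply: visits_cover => l _.
    exact: (mjp_state (mix_mjp mix k)).
pose E (x : {ffun 'I_M -> {ffun 'I_n -> 'I_p}}) :=
  [set w | forall k, visits (Xm k) t (extend i (x k)) n w].
have mE x : measurable (E x).
  rewrite (_ : E x = \big[setI/setT]_(k < M) visits (Xm k) t (extend i (x k)) n).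
    by apply: bigsetI_measurable => k _; exact: measurable_visits.
  rewrite -bigcap_seq; apply/seteqP; split => w /=.
    by move=> h k _; exact: h.
  by move=> h k; apply: h; rewrite /= mem_index_enum.
pose A := D i m `&` visits (Xm m) t (extend i y) n.
have mA : measurable A by apply: measurableI => //; exact: measurable_visits.
have AE x : prob (A `&` E x) =
    if x m == y then
      prob [set w | X0 w = label R i] * (s m ord0 i * \prod_k c k (x k))
    else 0.
  case: eqP => xm; last first.
    rewrite (_ : A `&` E x = set0) ?prob0//.
    apply/seteqP; split => w // [[_ hy] /(_ m) hx].
    by apply: xm; exact: visits_extend_inj hx hy.
  have mEphi : measurable ([set w | phi w = m.+1] `&` E x) by apply: measurableI.
  have := mix_independent mix m n (fun k => extend i (x k)) i0 t0 nd.
  rewrite -/(E x) cond_probE// (mix_regime mix m i0).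
  rewrite (eq_bigr (fun k => (c k (x k))%:E)); last first.
    by move=> k _; rewrite cond_probE//; exact: measurable_visits.
  rewrite prodEFin -EFinM => -[/(canRL (divfK pi0)) h].
  rewrite mulrC -h; congr prob; apply/seteqP; split => w.
    by move=> [[[wi wm] _] Ex].
  by move=> [[wm Ex] wi]; split => //; split => //; rewrite -xm; exact: Ex.
have -> : prob A = \sum_x prob (A `&` E x).
  rewrite (prob_split P (E := E))//.
  - move=> x z w hx hz; apply/ffunP => k.
    exact: visits_extend_inj (hx k) (hz k).
  - move=> w _.
    have /choice[x hx] : forall k : 'I_M,
        exists z : {ffun 'I_n -> 'I_p}, visits (Xm k) t (extend i z) n w.
      move=> k; apply: visits_cover => l _.
      exact: (mjp_state (mix_mjp mix k)).
    by exists (finfun x) => k; rewrite ffunE.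
rewrite (eq_bigr _ (fun x _ => AE x)) -big_mkcond/= -mulr_sumr -mulr_sumr.
have -> : \sum_(x : {ffun 'I_M -> {ffun 'I_n -> 'I_p}} | x m == y)
    \prod_k c k (x k) = c m y.
  transitivity (\prod_k \sum_(z | (k == m) ==> (z == y)) c k z).
    rewrite bigA_distr_big_dep; apply: eq_bigl => x.
    apply/idP/familyP => [/eqP xm k|/(_ m)]; last by rewrite unfold_in eqxx.
    by rewrite unfold_in; case: eqP => [->|//]; rewrite xm eqxx.
  rewrite (bigD1 m)//= eqxx (big_pred1 y)// [X in _ * X]big1 ?mulr1//.
  by move=> k km; rewrite (negbTE km)/= sum_c.
rewrite prob_mix_initial mulrA /c.
rewrite setIC mjp_path_law_from// prob_mix_initial.
rewrite prob_mix_initial in pi0.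
by rewrite [X in _ * (X / _)]mulrC mulfK.
Qed.

Lemma mixture_sample_law (t : nat -> R) n (B : nat -> set R) :
  0 <= t 0%N -> nondecreasing_seq t -> (forall k, measurable (B k)) ->
  P [set w | forall k, (k < n)%N -> B k (Y (t k) w)] =
  (\sum_(c : 'I_p * 'I_M * {ffun 'I_n -> 'I_p} |
      [forall k : 'I_n, label R (c.2 k) \in B k])
    ini ord0 c.1.1 * s c.1.2 ord0 c.1.1 *
      path_weight (Q c.1.2) c.1.1 t (extend c.1.1 c.2) n)%:E.
Proof.
move=> t0 nd mB; have tge0 k : 0 <= t k by rewrite (le_trans t0)// nd.
have dD i m i' m' w : D i m w -> D i' m' w -> i = i' /\ m = m'.
  move=> [Xi mE] [Xi' mE']; split; first by apply: (@label_inj R); rewrite -Xi -Xi'.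
  by move: mE; rewrite /= mE' => -[/esym/val_inj].
have [mG G1] := regimes_full hini hs mD dD prob_mix_regime.
apply: (@prob_samples _ _ _ Q ini s _ _ P Y D t n _ B _ mD dD mG G1) => //.
- move=> k; rewrite (_ : Y (t k) =
      fun w => \sum_(m < M) (phi w == m.+1)%:R * Xm m (t k) w).
    apply: measurable_sum => m; apply: measurable_funM.
      apply: (measurable_of_nat (fun l => (l == m.+1)%:R : R)).
      exact: mix_regime_measurable mix.
    exact: (mjp_measurable (mix_mjp mix m)).
  by apply/funext => w; rewrite (mix_repr mix).
- move=> w [i [m Dw]]; exists i, m; split => // k _.
  have [j Xj] := mjp_state (mix_mjp mix m) w (tge0 k).
  exists j; rewrite -Xj (mix_repr mix)// Dw.2 (bigD1 m)//= eqxx mul1r big1 ?addr0// => l lm.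
  by rewrite eqSS -[_ == _ :> nat]/(m == l) eq_sym (negbTE lm) mul0r.
- by move=> i m x; exact: mixture_path_weight.
Qed.

End MixtureLaw.

(** * The constructed process *)

Section Construction.
Context (R : realType) (p M : nat).
Variables (Q : 'I_M -> 'M[R]_p) (ini : 'rV[R]_p) (s : 'I_M -> 'rV[R]_p).
Context d (T : measurableType d) (P : probability T R).
Variables (U0 U : {RV P >-> R}) (V W : nat -> {RV P >-> R}).
Hypotheses (hQ : forall m, is_intensity (Q m)) (hini : is_distribution ini)
  (hs : is_switching s)
  (hunif : forall k, is_uniform01 (inputs U0 U V W k))
  (hindep : mutually_independent (inputs U0 U V W)).
Notation prob := (prob P).

Definition initial_state (w : T) : nat := select (fun i => ini ord0 i) (U0 w).

Definition regime (w : T) : nat :=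
  select (fun m => at_label (fun i => s m ord0 i) (initial_state w)) (U w).

Definition mixture_state n (w : T) : nat :=
  mixture_chain (fun m => jump_matrix (Q m)) (regime w) (initial_state w)
    (fun k => V k w) n.

Definition mixture_time n (w : T) : \bar R :=
  jump_time Q (regime w) (fun k => mixture_state k w) (fun k => W k w) n.

Definition mixture_path t (w : T) : R :=
  jump_path (fun n => mixture_state n w) (fun n => mixture_time n w) t.

Let D (i : 'I_p) (m : 'I_M) := [set w | in_slot (fun i => ini ord0 i) i (U0 w)] `&`
  [set w | in_slot (fun m => s m ord0 i) m (U w)].

Let ini0 i : 0 <= ini ord0 i.
Proof. exact: hini.1. Qed.

Let s0 i m : 0 <= s m ord0 i.
Proof. by have /andP[] := hs.1 m i. Qed.

Lemma initial_regimeP (i : 'I_p) (m : 'I_M) w :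
  D i m w <-> initial_state w = i.+1 /\ regime w = m.+1.
Proof.
rewrite /regime; split=> [[Dw Dm]|[Xi]].
  have Xi : initial_state w = i.+1 by exact: select_slot.
  split=> //; rewrite Xi; under [X in select X]eq_fun do rewrite at_label_ord.
  exact: select_slot.
rewrite Xi; under [X in select X]eq_fun do rewrite at_label_ord.
move=> /eqP; rewrite select_eq// => Dm; split => //=.
by move/eqP: Xi; rewrite /initial_state select_eq.
Qed.

Lemma prob_initial_regime i m : prob (D i m) = ini ord0 i * s m ord0 i.
Proof.
have mU : measurable [set r | in_slot (fun m => s m ord0 i) m r].
  by apply: measurable_set_of_bool; exact: measurable_in_slot.
have mU0 : measurable [set r | in_slot (fun i => ini ord0 i) i r].
  by apply: measurable_set_of_bool; exact: measurable_in_slot.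
rewrite (@prob_independent _ _ _ P _ _ (pred1 (inl false)) _ hindep (hunif (inl true)) isT
    _ [set r | in_slot (fun m => s m ord0 i) m r] (s m ord0 i))//.
- rewrite -[X in prob X]setTI.
  rewrite (@prob_independent _ _ _ P _ _ pred0 _ hindep (hunif (inl false)) isT
    _ [set r | in_slot (fun i => ini ord0 i) i r] (ini ord0 i))//.
    by rewrite prob1 mulr1 mulrC.
  by apply: uniform_slot => //; rewrite hini.2.
- apply: measurable_set_of_bool; apply: (measurableT_comp (measurable_in_slot _ _)).
  exact: (@measurable_fun_input _ _ _ P _ (inputs U0 U V W) _ (inl false)).
- by apply: uniform_slot => //; rewrite hs.2.
Qed.

Let mD1 i m :
  measurable (D i m : set (past (inputs U0 U V W) (fun k => input_rank k < 1)%N)).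
Proof.
apply: measurableI.
  apply: measurable_set_of_bool; apply: (measurableT_comp (measurable_in_slot _ _)).
  exact: (@measurable_fun_input _ _ _ P _ (inputs U0 U V W) _ (inl false)).
apply: measurable_set_of_bool; apply: (measurableT_comp (measurable_in_slot _ _)).
exact: (@measurable_fun_input _ _ _ P _ (inputs U0 U V W) _ (inl true)).
Qed.

Let mD i m : measurable (D i m).
Proof. exact: past_measurable (mD1 i m). Qed.

Let dD i m i' m' w : D i m w -> D i' m' w -> i = i' /\ m = m'.
Proof.
move=> /initial_regimeP[Xi mE] /initial_regimeP[Xi' mE'].
by split; apply/val_inj/succn_inj; [rewrite -Xi -Xi'|rewrite -mE -mE'].
Qed.

Lemma mixture_path_regime (m : 'I_M) t w : regime w = m.+1 ->
  mixture_path t w =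
  jump_path (fun n => regime_chain (jump_matrix (Q m)) (initial_state w)
                        (fun k => V k w) n)
    (fun n => mixture_time n w) t.
Proof.
move=> wm; rewrite /mixture_path; congr (jump_path _ _ _); apply/funext => n.
by rewrite /mixture_state wm mixture_chain_regime.
Qed.

Lemma mixture_path_on i m t w : D i m w ->
  mixture_path t w = regime_path (Q m) i V W t w.
Proof.
move=> /initial_regimeP[Xi wm].
have ZE : (fun n => mixture_state n w) = (regime_state (Q m) i V)^~ w.
  by apply/funext => n; rewrite /mixture_state wm mixture_chain_regime Xi.
rewrite /mixture_path /regime_path ZE; congr (jump_path _ _ _).
by apply/funext => n; rewrite /mixture_time wm ZE jump_time_regime.
Qed.

(** Without a regime all jump times are 0, and no interval [T_n, T_(n+1)[ contains t. *)
Lemma mixture_path_no_regime t w : 0 <= t ->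
  (forall m : 'I_M, regime w != m.+1) -> mixture_path t w = 0.
Proof.
move=> t0 wm; apply: jump_path_out => n.
have tau0 k : mixture_time k w = 0%E.
  rewrite /mixture_time; elim: k => //= k ->.
  rewrite big1 ?sube0// => l _; by rewrite (negbTE (wm l)) mul0e.
by rewrite !tau0 lee_fin t0/= lte_fin ltNge t0.
Qed.

Lemma mixture_path_off t w : 0 <= t -> (forall i m, ~ D i m w) ->
  mixture_path t w = 0.
Proof.
move=> t0 nD; apply: mixture_path_no_regime => // m; apply/eqP => wm.
have [[i Xi]|Xi] := labelP p (initial_state w).
  by apply: (nD i m); apply/initial_regimeP.
move: wm; rewrite /regime.
under [X in select X]eq_fun do rewrite at_label_eq0//.
by rewrite select0.
Qed.

(** An identity at every outcome, whence measurability on the whole space. *)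
Lemma mixture_path_sum t w : 0 <= t -> mixture_path t w =
  \sum_(c : 'I_p * 'I_M)
    (if w \in D c.1 c.2 then regime_path (Q c.2) c.1 V W t w else 0).
Proof.
move=> t0; have [[i [m Dw]]|nD] := pselect (exists i m, D i m w).
  rewrite (bigD1 (i, m))//= mem_set// big1 ?addr0 ?(mixture_path_on _ Dw)//.
  move=> [i' m'] /= ne; rewrite memNset// => Dw'.
  by have [ii mm] := dD Dw Dw'; rewrite ii mm eqxx in ne.
rewrite mixture_path_off//; last by move=> i m Dw; apply: nD; exists i, m.
by rewrite big1// => -[i m] _; rewrite memNset// => Dw; apply: nD; exists i, m.
Qed.

Lemma measurable_mixture_path t : 0 <= t -> measurable_fun setT (mixture_path t).
Proof.
move=> t0; rewrite (_ : mixture_path t = fun w => \sum_(c : 'I_p * 'I_M)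
   (if w \in D c.1 c.2 then regime_path (Q c.2) c.1 V W t w else 0)).
  apply: measurable_sum => -[i m]; apply: measurable_fun_ifT => //.
    apply: measurable_bool_of_set; rewrite (_ : [set w | _] = D i m)//.
    by apply/seteqP; split => w /=; [exact: set_mem|exact: mem_set].
  exact: (measurable_path (Q m) i U0 U V W t).
by apply/funext => w; exact: mixture_path_sum.
Qed.

Let Reg : set T := [set w | exists i m, D i m w].

Lemma prob_on_regime i m t (j : 'I_p) : 0 <= t ->
  prob (D i m `&` [set w | mixture_path t w = label R j]) =
  ini ord0 i * s m ord0 i * expm (t *: Q m) i j.
Proof.
move=> t0; rewrite -prob_initial_regime.
have := @regime_fdd R p (Q m) i d T P U0 U V W (hQ m) hunif hindep (D i m)
  (fun=> t) (fun=> j) 1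
  (mD1 i m) t0 (fun _ _ _ => lexx t).
rewrite /path_weight big_ord1/= subr0 => <-; congr prob.
apply/seteqP; split => w [Dw h]; split => //.
  by move=> [|//] _; rewrite -(mixture_path_on _ Dw).
by rewrite /= (mixture_path_on _ Dw); exact: (h 0%N).
Qed.

(** No explosion: the rows of the exponential sum to 1, so that no mass is lost. *)
Lemma state_full t : 0 <= t ->
  let G := [set w | exists i m, D i m w /\
                      exists j : 'I_p, mixture_path t w = label R j] in
  measurable G /\ P (~` G) = 0%E.
Proof.
move=> t0 G.
have mXj (j : 'I_p) : measurable [set w | mixture_path t w = label R j].
  rewrite -[X in measurable X]setTI.
  exact: (measurable_mixture_path t0 measurableT (measurable_set1 (label R j))).
pose E (c : 'I_p * 'I_M * 'I_p) :=
  D c.1.1 c.1.2 `&` [set w | mixture_path t w = label R c.2].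
have mE c : measurable (E c) by apply: measurableI.
have GE : G = \big[setU/set0]_c E c.
  rewrite -bigcup_seq; apply/seteqP; split => w /=.
    by move=> [i [m [Dw [j Xj]]]]; exists (i, m, j); rewrite //= mem_index_enum.
  by move=> [[[i m] j] _ [Dw Xj]]; exists i, m; split => //; exists j.
have mG : measurable G by rewrite GE; apply: bigsetU_measurable.
split => //; apply: prob_full => //.
rewrite (prob_split P (E := E))//.
- rewrite -(sum_regimes hini hs).
  rewrite -(pair_bigA _ (fun c j => prob (G `&` E (c, j))))/=.
  apply: eq_bigr => -[i m] _ /=.
  rewrite -[RHS]mulr1 -(sum_expm_row t i (intensity_sum0 (hQ m))) mulr_sumr.
  apply: eq_bigr => j _; rewrite -prob_on_regime//; congr prob.
  apply/seteqP; split => w; first by move=> [].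
  by move=> [Dw Xj]; split => //; exists i, m; split => //; exists j.
- move=> [[i m] j] [[i' m'] j'] w [/= Dw Xj] [/= Dw' Xj'].
  have [-> ->] := dD Dw Dw'; congr (_, _).
  by apply: (@label_inj R); rewrite -Xj -Xj'.
- by move=> w [i [m [Dw [j Xj]]]]; exists (i, m, j).
Qed.

Lemma construction_sample_law (t : nat -> R) n (B : nat -> set R) :
  0 <= t 0%N -> nondecreasing_seq t -> (forall k, measurable (B k)) ->
  P [set w | forall k, (k < n)%N -> B k (mixture_path (t k) w)] =
  (\sum_(c : 'I_p * 'I_M * {ffun 'I_n -> 'I_p} |
      [forall k : 'I_n, label R (c.2 k) \in B k])
    ini ord0 c.1.1 * s c.1.2 ord0 c.1.1 *
      path_weight (Q c.1.2) c.1.1 t (extend c.1.1 c.2) n)%:E.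
Proof.
move=> t0 nd mB; have tge0 k : 0 <= t k by rewrite (le_trans t0)// nd.
pose L k := [set w | exists i m, D i m w /\
                       exists j : 'I_p, mixture_path (t k) w = label R j].
have mL k : measurable (L k) by have [] := state_full (tge0 k).
have mG : measurable (\bigcap_k L k) by exact: bigcapT_measurable.
have G1 : P (~` \bigcap_k L k) = 0%E.
  apply/(negligibleP _ (measurableC mG)); rewrite setC_bigcap.
  apply: negligible_bigcup => k; apply/negligibleP; first exact: measurableC.
  by have [] := state_full (tge0 k).
apply: (prob_samples _ mD dD mG G1) => //.
- by move=> k; exact: measurable_mixture_path.
- move=> w Gw; have [i [m [Dw _]]] := Gw 0%N I.
  exists i, m; split => // k _.
  by have [i' [m' [_]]] := Gw k I.
- move=> i m x; rewrite -prob_initial_regime.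
  rewrite -(@regime_fdd _ _ _ i _ _ P U0 U V W (hQ m) hunif hindep _ _ _ _ (mD1 i m))//.
  congr prob; apply/seteqP; split => w [Dw h]; split => // k kn.
    by rewrite -(mixture_path_on _ Dw); exact: h.
  by rewrite (mixture_path_on _ Dw); exact: h.
Qed.

Lemma start_full :
  measurable (regular W `&` Reg) /\ P (~` (regular W `&` Reg)) = 0%E.
Proof.
have [mR R1] := regimes_full hini hs mD dD prob_initial_regime.
have mW := measurable_regular W.
have mWR : measurable (regular W `&` Reg) by exact: measurableI.
split => //; apply: prob_full => //.
rewrite setIC prob_setI//; last exact: regular_full hunif.
by rewrite -[RHS](prob1 P) -(prob_setI mR R1 measurableT) setTI.
Qed.

Lemma mixture_path_start w : regular W w -> Reg w ->
  mixture_path 0 w = (initial_state w)%:R.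
Proof.
move=> rw [i [m Dw]]; rewrite (mixture_path_on _ Dw) (path_start _ _ (hQ m))//.
by have [-> _] := (initial_regimeP _ _ _).1 Dw.
Qed.

Lemma prob_start A i (f : 'I_M -> R) : measurable A ->
  (forall m, prob (D i m `&` A) = ini ord0 i * s m ord0 i * f m) ->
  prob (A `&` [set w | mixture_path 0 w = label R i]) =
  ini ord0 i * \sum_m s m ord0 i * f m.
Proof.
move=> mA fA; have [mG G1] := start_full.
have mX0 : measurable [set w | mixture_path 0 w = label R i].
  rewrite -[X in measurable X]setTI.
  exact: (measurable_mixture_path (lexx 0) measurableT (measurable_set1 (label R i))).
rewrite -(prob_setI mG G1); last exact: measurableI.
rewrite (prob_split P (E := fun m => D i m)).
- rewrite mulr_sumr; apply: eq_bigr => m _; rewrite mulrA -fA.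
  apply: (prob_eq_on mG G1).
  + by do 2 apply: measurableI => //; exact: measurableI.
  + exact: measurableI.
  + move=> w Gw; split => [[[[? ?] ?] ?]//|[Dw Aw]]; split => //; split => //; split => //.
    case: Gw => rw Rw; rewrite /= mixture_path_start//.
    by have [-> _] := (initial_regimeP _ _ _).1 Dw.
- by apply: measurableI => //; exact: measurableI.
- by move=> m.
- by move=> m m' w Dw Dw'; have [] := dD Dw Dw'.
- move=> w [[_ /= Xi] [rw Rw]]; case: (Rw) => i' [m Dw]; exists m.
  move: Xi; rewrite mixture_path_start//.
  have [-> _] := (initial_regimeP _ _ _).1 Dw.
  by move=> /(@label_inj R _ i') <-.
Qed.

End Construction.

Theorem theorem2p4 (R : realType) (p M : nat)
    (Q : 'I_M -> 'M[R]_p) (ini : 'rV[R]_p) (s : 'I_M -> 'rV[R]_p)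
    (d : measure_display) (T : measurableType d) (P : probability T R)
    (U0 U : {RV P >-> R}) (V W : nat -> {RV P >-> R})
    (hQ : forall m, is_intensity (Q m))
    (hini : is_distribution ini)
    (hs : is_switching s)
    (hunif : forall k, is_uniform01 (inputs U0 U V W k))
    (hindep : mutually_independent (inputs U0 U V W)) :
  let X0 := fun w : T => select (fun i => ini ord0 i) (U0 w) in
  let phi := fun w : T =>
    select (fun m => at_label (fun i => s m ord0 i) (X0 w)) (U w) in
  let Phi := fun (m : 'I_M) (w : T) => (phi w == m.+1)%:R : R in
  let Pi := fun m => jump_matrix (Q m) in
  let Zm := fun (m : 'I_M) (n : nat) (w : T) =>
    regime_chain (Pi m) (X0 w) (fun k => V k w) n in
  let Z := fun (n : nat) (w : T) =>
    mixture_chain Pi (phi w) (X0 w) (fun k => V k w) n in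
  let tau := fun (n : nat) (w : T) =>
    jump_time Q (phi w) (fun k => Z k w) (fun k => W k w) n in
  let X := fun (t : R) (w : T) =>
    jump_path (fun n => Z n w) (fun n => tau n w) t in
  let Xm := fun (m : 'I_M) (t : R) (w : T) =>
    jump_path (fun n => Zm m n w) (fun n => tau n w) t in
  [/\ {ae P, forall w, X 0 w = (X0 w)%:R},
      forall (t : R) (w : T), 0 <= t ->
        X t w = \sum_(m < M) Phi m w * Xm m t w,
      forall (d' : measure_display) (T' : measurableType d')
        (P' : probability T' R) (phi' : T' -> nat)
        (Xm' : 'I_M -> R -> T' -> R) (X0' : T' -> R) (Y : R -> T' -> R),
        is_mixture_of_mjp P' Q ini s phi' Xm' X0' Y ->
        same_distribution P X P' Y
    & forall (t : R) (i j : 'I_p), 0 <= t ->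
        P [set w | X 0 w = label R i] != 0%E ->
        cond_prob P [set w | X t w = label R j] [set w | X 0 w = label R i] =
        ((\sum_(m < M) diag_mx (s m) *m expm (t *: Q m)) i j)%:E].
Proof.
move=> X0 phi Phi Pi Zm Z tau X Xm; split.
- have [mG G1] := start_full hini hs hunif hindep.
  eexists; split; [exact: measurableC mG|exact: G1|].
  move=> w h [rw Rw]; apply: h.
  exact: (mixture_path_start V hQ hini hs rw Rw).
- move=> t w t0.
  have [[m wm]|wm] := labelP M (phi w).
    rewrite (bigD1 m)//= /Phi wm eqxx mul1r big1 ?addr0.
      exact: mixture_path_regime.
    by move=> l lm; rewrite eqSS -[_ == _ :> nat]/(m == l) eq_sym (negbTE lm) mul0r.
  rewrite big1; first exact: mixture_path_no_regime.
  by move=> m _; rewrite /Phi (negbTE (wm m)) mul0r.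
- move=> d' T' P' phi' Xm' X0' Y mix n t B t0 nd mB.
  rewrite (mixture_sample_law hini hs mix n t0 nd mB).
  exact: construction_sample_law.
- move=> t i j t0 Pi0.
  have mXj (u : R) (k : 'I_p) : 0 <= u -> measurable [set w | X u w = label R k].
    move=> u0; have mXu : measurable_fun setT (X u) by exact: measurable_mixture_path.
    rewrite -[Y in measurable Y]setTI.
    exact: (mXu measurableT _ (measurable_set1 (label R k))).
  have X0i := mXj 0 i (lexx 0); have Xtj := mXj t j t0.
  rewrite cond_probE//; congr EFin.
  rewrite (@prob_start _ _ _ Q ini s _ _ P U0 U V W hQ hini hs hunif hindep _ i
    (fun m => expm (t *: Q m) i j) Xtj); last first.
    by move=> m; exact: prob_on_regime.
  have pX0 : prob P [set w | X 0 w = label R i] = ini ord0 i.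
    rewrite -[X in prob P X]setTI.
    rewrite (@prob_start _ _ _ Q ini s _ _ P U0 U V W hQ hini hs hunif hindep _ i
      (fun=> 1) measurableT).
      by under eq_bigr do rewrite mulr1; rewrite hs.2 mulr1.
    by move=> m; rewrite setIT mulr1; exact: prob_initial_regime.
  rewrite pX0 mulrAC divff ?mul1r; last by move: Pi0; rewrite probE// eqe pX0.
  rewrite summxE; apply: eq_bigr => m _.
  by rewrite mul_diag_mx [RHS]mxE.
Qed.
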